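(* Let $k>1$ be an integer, let $C>0$ be a constant, and let $\mathcal{H}$ be a family of holomorphic maps $\Phi:\mathbb{B}^k\to\mathbb{C}^k$ such that for every $\Phi\in\mathcal{H}$ and every $a\in\mathbb{B}^k$ the matrix $\Phi'(a)$ is invertible and $$\|\Phi'(a)\|\cdot\|\Phi'(a)^{-1}\|\le C .$$ If $\mathcal{H}$ is not normal on $\mathbb{B}^k$, then, after reparametrization, one can extract from $\mathcal{H}$ a sequence converging to a non-degenerate holomorphic map $\Psi:\mathbb{C}^k\to\mathbb{C}^k$. That is, there exist a sequence $(\Phi_n)$ of elements of $\mathcal{H}$, points $a_n\in\mathbb{B}^k$, invertible complex $k\times k$ matrices $B_n$ and radii $r_n\to+\infty$ such that $a_n+B_nz\in\mathbb{B}^k$ whenever $|z|<r_n$, and the maps $\Psi_n(z):=\Phi_n(a_n+B_nz)$, defined for $|z|<r_n$, converge uniformly on compact subsets of $\mathbb{C}^k$ to a non-degenerate holomorphic map $\Psi:\mathbb{C}^k\to\mathbb{C}^k$.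
   Context: $\mathbb{B}^k$ is the open unit ball of $\mathbb{C}^k$ for the Euclidean norm $|\cdot|$. $\Phi'(a)$ denotes the complex Jacobian matrix of $\Phi$ at $a$, and $\|\cdot\|$ is the operator norm on $k\times k$ complex matrices. A family of holomorphic maps $\mathbb{B}^k\to\mathbb{C}^k$ is normal if every sequence in it has a subsequence that either converges uniformly on compact subsets of $\mathbb{B}^k$ to a holomorphic map $\mathbb{B}^k\to\mathbb{C}^k$, or tends to $\infty$ uniformly on compact subsets of $\mathbb{B}^k$. A holomorphic map $\Psi:\mathbb{C}^k\to\mathbb{C}^k$ is non-degenerate if its Jacobian determinant $\det\Psi'$ is not identically zero. *)

(* Defs.v *)
From HB Require Import structures.
From mathcomp Require Import all_boot all_order all_algebra.
From mathcomp Require Import complex.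
From mathcomp Require Import all_classical all_reals all_analysis.
Set Implicit Arguments.
Unset Strict Implicit.
Unset Printing Implicit Defensive.
Import Order.TTheory GRing.Theory Num.Theory numFieldNormedType.Exports.
Local Open Scope classical_set_scope.
Local Open Scope ring_scope.

(* The complex numbers R[i], with the structure carried explicitly: the
   canonical topology and norm of MathComp-Analysis are attached to the
   coercion of numFieldType and are not inferred on a bare R[i]. *)
Definition Cx (R : realType) : numFieldType := R[i].

(* C^k is represented by the row vectors 'rV[Cx R]_k, and, as everywhere in
   MathComp, matrices act on the right: the linear map with matrix B is
   z |-> z *m B. The library Jacobian 'J f a follows this convention
   ('d f a z = z *m 'J f a), so that each matrix below is the transpose of its
   column-vector counterpart.
   The canonical norm of 'rV[Cx R]_k is the sup norm; it is only used through
   the topology and uniformity it induces (differentiability, compactness,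
   uniform convergence), and these agree with the Euclidean ones. Balls and
   operator norms are taken with respect to enorm. *)

Section defs.
Variables (R : realType) (k : nat).
Implicit Types (f g : 'rV[Cx R]_k -> 'rV[Cx R]_k) (D : set 'rV[Cx R]_k).

Definition enorm (z : 'rV[Cx R]_k) : R :=
  Num.sqrt (\sum_(j < k)
    (complex.Re (z ord0 j) ^+ 2 + complex.Im (z ord0 j) ^+ 2)).

Definition eball (r : R) : set 'rV[Cx R]_k := [set z | enorm z < r].

Definition opnorm (A : 'M[Cx R]_k) : R :=
  sup [set enorm (z *m A) | z in [set z | enorm z <= 1]].

(* Maps defined on an open set D are represented by total functions, whose
   values outside D are irrelevant; [differentiable] is over the field Cx R. *)
Definition holomorphic_on D f := forall a, D a -> differentiable f a.

Definition cvg_locunif D (F : nat -> 'rV[Cx R]_k -> 'rV[Cx R]_k) f :=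
  {family compactly_in D, F @ \oo --> f}.

Definition cvg_infty D (F : nat -> 'rV[Cx R]_k -> 'rV[Cx R]_k) :=
  forall K, compactly_in D K ->
  forall M : R, \forall n \near \oo, forall z, K z -> M < enorm (F n z).

Definition normal_on D (H : set ('rV[Cx R]_k -> 'rV[Cx R]_k)) :=
  forall F : nat -> 'rV[Cx R]_k -> 'rV[Cx R]_k, (forall n, H (F n)) ->
  exists phi : nat -> nat, increasing_seq phi /\
    ((exists g, holomorphic_on D g /\ cvg_locunif D (F \o phi) g) \/
     cvg_infty D (F \o phi)).

Definition nondegenerate_map f := ~ (forall z, \det ('J f z) = 0).

End defs.

Arguments eball {R k} r.

(* Main.v *)
Require Import Defs.
From HB Require Import structures.
From mathcomp Require Import all_boot all_order all_algebra.
From mathcomp Require Import complex.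
From mathcomp Require Import all_classical all_reals all_analysis.
From mathcomp Require Import ring lra.
(** Write J for the differential of a map and <<w>> for sqrt (1 + |w|^2). The
metric |dw| / <<w>> on C^k is complete, so a bound |J Phi| <= L <<Phi>> on each
smaller ball, uniform over the family, makes log <<Phi>> Lipschitz there: along
a sequence the values are either locally bounded, and Cauchy's estimate gives a
locally uniform holomorphic limit, or they tend to infinity locally uniformly.
Hence a family that is not normal has members Phi and points p at which
|J Phi| / <<Phi>> is as large as one likes (normal_criterion). Choosing p nearly
extremal for a weighted version of this quotient (point_picking) and putting
Psi (z) = Phi (p + z B) with B = <<Phi (p)>> (J Phi p)^-1 gives maps Psi_n on
balls of radius r_n -> +oo with

  J Psi_n (0) = b_n I where b_n = <<Psi_n (0)>>,   |J Psi_n| <= 4 C <<Psi_n>>,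

and distortion at most C^2, because the distortion of B is at most C (rescale).

The maps G_n = Psi_n / b_n satisfy J G_n (0) = I. By Gronwall's inequality they
are locally bounded, hence converge to an entire map g, along an ultrafilter.
This limit is affine (affine_limit). Indeed, for a constant matrix E the map
J G_n^-1 E J G_n is holomorphic and bounded by C^2 |E| on a ball of radius r_n.
By Cauchy's estimate it is nearly constant, so that E commutes with J g (z) in
the limit; E being arbitrary, J g = phi I for a scalar function phi. If k > 1,
this forces phi to be constant: the j-th component of g depends on z_j only,
hence so does phi, for each j. Therefore g (z) = g (0) + z.

In particular g vanishes at - g (0). The lower half of Gronwall's inequality,
b_n <= <<Psi_n (z)>> exp (4 C |z|), applied at this zero, bounds b_n. So b_n
converges to some b >= 1 along the ultrafilter, and Psi_n = b_n G_n converges to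
the affine isomorphism z |-> b (g (0) + z), which is non-degenerate. A sequence
is extracted from the ultrafilter at the end.

The only complex analysis behind this is Cauchy's estimate |f' (0)| <= M / r for
a complex differentiable f with |f - f (0)| <= M on the disc of radius r. It
follows from the mean value property of (f (z) - f (0)) / z at 0, that is, from
Goursat's lemma for one rectangle in the coordinates (log |z|, arg z). Limits of
holomorphic maps, and the differentials themselves, are holomorphic because
Cauchy's estimate also controls differences of members of a bounded family
(montel_jac, partial_diff). *)

Set Implicit Arguments.
Unset Strict Implicit.
Unset Printing Implicit Defensive.
Import Order.TTheory GRing.Theory Num.Theory numFieldNormedType.Exports.
Local Open Scope classical_set_scope.
Local Open Scope ring_scope.

(** * Goursat's lemma in real form *)

Section Goursat.
Variable R : realType.
Implicit Types (a b c d x y : R) (f g : R -> R) (P S : R -> R -> R).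

Definition segint a b f := \int[@lebesgue_measure R]_(x in `[a, b]) f x.

(** Total differentiability at (x0, y0), with partial derivatives p and q. *)
Definition has_grad P x0 y0 (p q : R) := forall e, 0 < e -> exists2 dl, 0 < dl &
  forall x y, `|x - x0| <= dl -> `|y - y0| <= dl ->
  `|P x y - P x0 y0 - p * (x - x0) - q * (y - y0)|
    <= e * (`|x - x0| + `|y - y0|).

Lemma segint_integrable a b f : {in `[a, b], continuous f} ->
  (@lebesgue_measure R).-integrable `[a, b] (EFin \o f).
Proof.
move=> cf; apply: continuous_compact_integrable; first exact: segment_compact.
by apply: continuous_in_subspaceT => x /set_mem xab; apply: cf.
Qed.

Lemma segint_split a m b f : a <= m -> m <= b -> {in `[a, b], continuous f} ->
  segint a b f = segint a m f + segint m b f.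
Proof.
move=> am mb cf; have fi := segint_integrable cf.
have := @Rintegral_itvB R f (BLeft a) (BRight b) m fi.
rewrite !bnd_simp => /(_ am mb) E.
have E2 : segint m b f = \int[@lebesgue_measure R]_(x in `]m, b]) f x.
  rewrite /segint -(@Rintegral_itv_obnd_cbnd R m (BRight b)) //.
  apply: integrableS fi => //=.
  by apply: subset_itvr; rewrite bnd_simp.
by rewrite E2 -E /segint addrC subrK.
Qed.

Lemma segint_bound a b f g (k e : R) : a <= b ->
  {in `[a, b], continuous f} -> {in `[a, b], continuous g} ->
  (forall x, a <= x <= b -> `|f x - g x - k| <= e) ->
  `|segint a b f - segint a b g - k * (b - a)| <= e * (b - a).
Proof.
move=> ab cf cg H.
have fi := segint_integrable cf; have gi := segint_integrable cg.
have icst r : segint a b (cst r) = r * (b - a).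
  rewrite /segint Rintegral_cst //= lebesgue_measure_itv /= lte_fin.
  by move: ab; rewrite le_eqVlt => /orP[/eqP->|->] //=; rewrite ltxx subrr mulr0.
have ci r : (@lebesgue_measure R).-integrable `[a, b] (EFin \o cst r).
  by apply: segint_integrable => x _; apply: cst_continuous.
have E : segint a b f - segint a b g = segint a b (fun x => f x - g x).
  by rewrite /segint RintegralB.
have fgi : (@lebesgue_measure R).-integrable `[a, b] (EFin \o (fun x => f x - g x)).
  apply: segint_integrable => x xab; apply: continuousB; [exact: cf|exact: cg].
rewrite E ler_norml; apply/andP; split.
  rewrite -subr_ge0 opprK -addrA -mulNr -!mulrDl.
  rewrite -[X in _ + X]opprK -mulNr -icst subr_ge0.
  apply: le_Rintegral => //= x; rewrite in_itv /= => /H.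
  by rewrite ler_norml => /andP[]; lra.
rewrite lerBlDr -mulrDl -icst.
apply: le_Rintegral => //= x; rewrite in_itv /= => /H.
by rewrite ler_norml => /andP[]; lra.
Qed.

Lemma has_grad_cont1 P x y p q : has_grad P x y p q -> {for x, continuous (P ^~ y)}.
Proof.
move=> /(_ 1 ltr01)[dl dl0 H]; apply/cvgrPdist_le => e e0.
pose N := `|p| + 1; have N0 : 0 < N by rewrite ltr_wpDl.
exists (Num.min dl (e / N)); first by rewrite /= lt_min dl0 divr_gt0.
move=> z /=; rewrite lt_min => /andP[/ltW z1 /ltW z2].
rewrite distrC in z1 z2.
have := H z y z1; rewrite subrr normr0 mulr0 subr0 addr0 mul1r => /(_ (ltW dl0)) H1.
rewrite distrC; have : `|P z y - P x y| <= N * `|z - x|.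
  rewrite -[P z y - P x y](subrK (p * (z - x))) (le_trans (ler_normD _ _)) //.
  by rewrite normrM mulrDl mul1r addrC lerD2l.
by move=> /le_trans -> //; rewrite mulrC -ler_pdivlMr.
Qed.

Lemma has_grad_sym P x y p q : has_grad P x y p q -> has_grad (fun y x => P x y) y x q p.
Proof.
move=> H e /H[dl dl0 K]; exists dl => // u v hu hv.
by rewrite addrAC [`|u - _| + _]addrC; apply: K.
Qed.

Lemma has_grad_cont2 P x y p q : has_grad P x y p q -> {for y, continuous (P x)}.
Proof. by move=> /has_grad_sym/has_grad_cont1. Qed.

(** The integral of P dx + S dy along the boundary of [a, b] x [c, d], with
    opposite sides paired. *)
Definition loopint P S a b c d := segint a b (P ^~ c) - segint a b (P ^~ d)
  + (segint c d (S b) - segint c d (S a)).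

Lemma dist_itv a b x y w : a <= y <= b -> a <= x <= b -> b - a = w -> `|x - y| <= w.
Proof. by rewrite ler_norml; lra. Qed.

Lemma four_quarters (t u v w e s : R) : t <= e * (s / 4) -> u <= e * (s / 4) ->
  v <= e * (s / 4) -> w <= e * (s / 4) -> t + u + (v + w) <= e * s.
Proof. by lra. Qed.

Section closed_form.
Variables (P S p q r : R -> R -> R) (A B C D : R).
Hypothesis dP : forall x y, A <= x <= B -> C <= y <= D ->
  has_grad P x y (p x y) (q x y).
Hypothesis dS : forall x y, A <= x <= B -> C <= y <= D ->
  has_grad S x y (q x y) (r x y).

Let cP a b y : A <= a -> b <= B -> C <= y <= D -> {in `[a, b], continuous (P ^~ y)}.
Proof.
move=> Aa bB Cy x; rewrite in_itv /= => /andP[ax xb].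
by apply: (@has_grad_cont1 _ _ _ (p x y) (q x y)); apply: dP => //;
  rewrite (le_trans Aa) ?(le_trans xb).
Qed.

Let cS c d x : C <= c -> d <= D -> A <= x <= B -> {in `[c, d], continuous (S x)}.
Proof.
move=> Cc dD Ax y; rewrite in_itv /= => /andP[cy yd].
by apply: (@has_grad_cont2 _ _ _ (q x y) (r x y)); apply: dS => //;
  rewrite (le_trans Cc) ?(le_trans yd).
Qed.

Lemma loopint_split a m b c n d : A <= a -> a <= m -> m <= b -> b <= B ->
  C <= c -> c <= n -> n <= d -> d <= D ->
  loopint P S a b c d = (loopint P S a m c n + loopint P S m b c n)
                        + (loopint P S a m n d + loopint P S m b n d).
Proof.
move=> Aa am mb bB Cc cn nd dD.
have ab := le_trans am mb; have cd := le_trans cn nd.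
rewrite /loopint.
rewrite (@segint_split a m b (P ^~ c)) //; last by apply: cP; lra.
rewrite (@segint_split a m b (P ^~ d)) //; last by apply: cP; lra.
rewrite (@segint_split c n d (S a)) //; last by apply: cS; lra.
rewrite (@segint_split c n d (S b)) //; last by apply: cS; lra.
lra.
Qed.

(** Opposite sides of a small rectangle of fixed shape: since P_y = S_x = q, the
    linear parts of P and S contribute - q |R| and + q |R|, where |R| is the area,
    and only the remainders, which are o(|R|), survive. *)
Lemma loopint_small x0 y0 (W H e : R) : A <= x0 <= B -> C <= y0 <= D ->
  0 < W -> 0 < H -> 0 < e ->
  exists2 dl, 0 < dl & forall a b c d t, A <= a <= x0 -> x0 <= b <= B ->
    C <= c <= y0 -> y0 <= d <= D -> b - a = W * t -> d - c = H * t ->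
    0 < t <= dl -> `|loopint P S a b c d| <= e * ((b - a) * (d - c)).
Proof.
move=> x0i y0i W0 H0 e0.
pose eta := e * (W * H) / (2 * (W + H) ^+ 2).
have WH : 0 < W + H by rewrite addr_gt0.
have eta0 : 0 < eta by rewrite divr_gt0 ?mulr_gt0 ?exprn_gt0.
have [d1 d10 K1] := dP x0i y0i eta0.
have [d2 d20 K2] := dS x0i y0i eta0.
pose dm := Num.min d1 d2.
have dm0 : 0 < dm by rewrite lt_min d10.
exists (dm / (W + H)); first by rewrite divr_gt0.
move=> a b c d t /andP[Aa ax] /andP[xb bB] /andP[Cc cy] /andP[yd dD] bat dct /andP[t0 tl].
have Wt : 0 < W * t by rewrite mulr_gt0.
have Ht : 0 < H * t by rewrite mulr_gt0.
have tWH : W * t + H * t <= dm by rewrite -mulrDl mulrC -ler_pdivlMr.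
have dmE : dm <= d1 /\ dm <= d2.
  have : dm <= dm by []. by rewrite {2}/dm le_min => /andP[].
case: dmE => dm1 dm2.
have ab : a <= b by rewrite (le_trans ax).
have cd : c <= d by rewrite (le_trans cy).
have Wd : W * t <= dm by rewrite (le_trans _ tWH) // lerDl ltW.
have Hd : H * t <= dm by rewrite (le_trans _ tWH) // lerDr ltW.
have [W1 W2] : W * t <= d1 /\ W * t <= d2 by rewrite !(le_trans Wd).
have [H1 H2] : H * t <= d1 /\ H * t <= d2 by rewrite !(le_trans Hd).
have [Ab aB] : A <= b /\ a <= B by rewrite (le_trans Aa) // (le_trans ab).
have [Cd cD] : C <= d /\ c <= D by rewrite (le_trans Cc) // (le_trans cd).
have Bx x : a <= x <= b -> `|x - x0| <= W * t.
  by move=> xi; apply: (@dist_itv a b) => //; rewrite ax.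
have By y : c <= y <= d -> `|y - y0| <= H * t.
  by move=> yi; apply: (@dist_itv c d) => //; rewrite cy.
have EP : forall x, a <= x <= b ->
    `|P x c - P x d - q x0 y0 * (c - d)| <= 2 * eta * (W * t + H * t).
  move=> x /Bx hx.
  have hc : `|c - y0| <= H * t by apply: By; rewrite ?lexx ?cd.
  have hd : `|d - y0| <= H * t by apply: By; rewrite ?lexx ?cd.
  have := K1 x c; have := K1 x d; rewrite !(le_trans hx) ?(le_trans hc) ?(le_trans hd) //.
  move=> /(_ isT isT) k1 /(_ isT isT) k2.
  have -> : P x c - P x d - q x0 y0 * (c - d) =
    (P x c - P x0 y0 - p x0 y0 * (x - x0) - q x0 y0 * (c - y0)) -
    (P x d - P x0 y0 - p x0 y0 * (x - x0) - q x0 y0 * (d - y0)) by ring.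
  rewrite (le_trans (ler_normB _ _)) // -mulrA mulr2n mulrDl mul1r lerD //.
    by apply: (le_trans k2); rewrite ler_pM2l // lerD.
  by apply: (le_trans k1); rewrite ler_pM2l // lerD.
have ES : forall y, c <= y <= d ->
    `|S b y - S a y - q x0 y0 * (b - a)| <= 2 * eta * (W * t + H * t).
  move=> y /By hy.
  have hb : `|b - x0| <= W * t by apply: Bx; rewrite ?lexx ?ab.
  have ha : `|a - x0| <= W * t by apply: Bx; rewrite ?lexx ?ab.
  have := K2 b y; have := K2 a y; rewrite !(le_trans hy) ?(le_trans ha) ?(le_trans hb) //.
  move=> /(_ isT isT) k1 /(_ isT isT) k2.
  have -> : S b y - S a y - q x0 y0 * (b - a) =
    (S b y - S x0 y0 - q x0 y0 * (b - x0) - r x0 y0 * (y - y0)) -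
    (S a y - S x0 y0 - q x0 y0 * (a - x0) - r x0 y0 * (y - y0)) by ring.
  rewrite (le_trans (ler_normB _ _)) // -mulrA mulr2n mulrDl mul1r lerD //.
    by apply: (le_trans k2); rewrite ler_pM2l // lerD.
  by apply: (le_trans k1); rewrite ler_pM2l // lerD.
have I1 : `|segint a b (P ^~ c) - segint a b (P ^~ d) - q x0 y0 * (c - d) * (b - a)|
    <= 2 * eta * (W * t + H * t) * (b - a).
  by apply: segint_bound EP => //; apply: cP; rewrite ?Cc ?cD ?Cd.
have I2 : `|segint c d (S b) - segint c d (S a) - q x0 y0 * (b - a) * (d - c)|
    <= 2 * eta * (W * t + H * t) * (d - c).
  by apply: segint_bound ES => //; apply: cS; rewrite ?Aa ?aB ?Ab.
have -> : loopint P S a b c d =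
  (segint a b (P^~ c) - segint a b (P^~ d) - q x0 y0 * (c - d) * (b - a)) +
  (segint c d (S b) - segint c d (S a) - q x0 y0 * (b - a) * (d - c)).
  by rewrite /loopint; ring.
apply: (le_trans (ler_normD _ _)).
apply: (le_trans (lerD I1 I2)).
rewrite bat dct -mulrDr -!mulrDl /eta.
rewrite le_eqVlt; apply/orP; left; apply/eqP; field.
by rewrite gt_eqF.
Qed.

(** Bisection: if the integral did not vanish, it would exceed a fixed multiple
    of the area on a nested sequence of quarters, against loopint_small at their
    common point. *)
Lemma goursat : A < B -> C < D -> loopint P S A B C D = 0.
Proof.
move=> AB CD.
pose area (R4 : R * R * R * R) := let: (a, b, c, d) := R4 in (b - a) * (d - c).
pose J (R4 : R * R * R * R) := let: (a, b, c, d) := R4 in loopint P S a b c d.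
apply/eqP/negPn/negP => J0.
have a0 : 0 < area (A, B, C, D) by rewrite /= mulr_gt0 ?subr_gt0.
pose e := `|loopint P S A B C D| / area (A, B, C, D) / 2.
have e0 : 0 < e by rewrite !divr_gt0 // normr_gt0.
(* a rectangle with a large integral has a quarter with a large integral *)
pose sub (Q Q' : R * R * R * R) := let: (a, b, c, d) := Q in
  let: (a', b', c', d') := Q' in
  [/\ a <= a', b' <= b, c <= c', d' <= d &
    b' - a' = (b - a) / 2 /\ d' - c' = (d - c) / 2].
pose good (Q : R * R * R * R) := let: (a, b, c, d) := Q in
  [/\ A <= a, a < b, b <= B & [/\ C <= c, c < d & d <= D]] /\
  e * area Q < `|J Q|.
have step Q : exists Q', good Q -> good Q' /\ sub Q Q'.
  have [gQ|] := pselect (good Q); last by move=> ?; exists Q.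
  move: Q gQ => [[[a b] c] d] [[Aa ab bB [Cc cd dD]] big].
  pose m := (a + b) / 2; pose n := (c + d) / 2.
  have [am mb] : a < m /\ m < b by have [] := midf_lt ab.
  have [cn nd] : c < n /\ n < d by have [] := midf_lt cd.
  have E : J (a, b, c, d) = _ :=
    loopint_split Aa (ltW am) (ltW mb) bB Cc (ltW cn) (ltW nd) dD.
  have k (u v w z : R) : u - w = (b - a) / 2 -> v - z = (d - c) / 2 ->
     area (w, u, z, v) = area (a, b, c, d) / 4.
    by move=> /= -> ->; field.
  have [[am' mb'] [cn' nd']] : (a <= m /\ m <= b) /\ (c <= n /\ n <= d).
    by rewrite !ltW.
  have [Am mB] : A <= m /\ m <= B by rewrite (le_trans Aa) // (le_trans _ bB).
  have [Cn nD] : C <= n /\ n <= D by rewrite (le_trans Cc) // (le_trans _ dD).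
  have [hma hbm] : m - a = (b - a) / 2 /\ b - m = (b - a) / 2.
    by rewrite /m; split; field.
  have [hnc hdn] : n - c = (d - c) / 2 /\ d - n = (d - c) / 2.
    by rewrite /n; split; field.
  have [h|h1] := ltP (e * area (a, m, c, n)) `|J (a, m, c, n)|.
    by exists (a, m, c, n) => _; do !split.
  have [h|h2] := ltP (e * area (m, b, c, n)) `|J (m, b, c, n)|.
    by exists (m, b, c, n) => _; do !split.
  have [h|h3] := ltP (e * area (a, m, n, d)) `|J (a, m, n, d)|.
    by exists (a, m, n, d) => _; do !split.
  have [h|h4] := ltP (e * area (m, b, n, d)) `|J (m, b, n, d)|.
    by exists (m, b, n, d) => _; do !split.
  exfalso; move: big; rewrite ltNge => /negP; apply.
  move: h1 h2 h3 h4; rewrite (k _ _ _ _ hma hnc) (k _ _ _ _ hbm hnc).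
  rewrite (k _ _ _ _ hma hdn) (k _ _ _ _ hbm hdn) => h1 h2 h3 h4.
  rewrite E (le_trans (ler_normD _ _)) //.
  rewrite (le_trans (lerD (ler_normD _ _) (ler_normD _ _))) //.
  by apply: four_quarters.
have [F HF] := choice step.
pose Q n := iter n F (A, B, C, D).
have gQ n : good (Q n).
  elim: n => [|n /HF[] //]; split; first by split => //; split.
  rewrite /e /J mulrAC divfK ?gt_eqF // ltr_pdivrMr // ltr_pMr ?normr_gt0 //.
  by rewrite ltr1n.
have sQ n : sub (Q n) (Q n.+1) by have [] := HF _ (gQ n).
pose a_ n := (Q n).1.1.1; pose b_ n := (Q n).1.1.2; pose c_ n := (Q n).1.2; pose d_ n := (Q n).2.
have QE n : Q n = (a_ n, b_ n, c_ n, d_ n) by rewrite /a_ /b_ /c_ /d_; case: (Q n) => [[[]]].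
have sz n : b_ n - a_ n = (B - A) * 2^-1 ^+ n /\ d_ n - c_ n = (D - C) * 2^-1 ^+ n.
  elim: n => [|n [IH1 IH2]]; first by rewrite !expr0 !mulr1.
  have := sQ n; rewrite !QE /sub => -[_ _ _ _ [-> ->]].
  by rewrite IH1 IH2 !exprSr; split; field.
have mono n : a_ n <= a_ n.+1 /\ b_ n.+1 <= b_ n /\ c_ n <= c_ n.+1 /\ d_ n.+1 <= d_ n.
  by have := sQ n; rewrite !QE /sub => -[].
have mon_a n m : (n <= m)%N -> a_ n <= a_ m.
  by move=> /(homo_leq (@lexx _ _) (@le_trans _ _)); apply=> k; have [] := mono k.
have mon_c n m : (n <= m)%N -> c_ n <= c_ m.
  by move=> /(homo_leq (@lexx _ _) (@le_trans _ _)); apply=> k; have [_ [_ []]] := mono k.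
have mon_b n m : (n <= m)%N -> b_ m <= b_ n.
  move=> /(@homo_leq _ b_ (fun x y => y <= x)); apply; first exact: lexx.
    by move=> x y z xy yz; apply: le_trans xy.
  by move=> k; have [_ []] := mono k.
have mon_d n m : (n <= m)%N -> d_ m <= d_ n.
  move=> /(@homo_leq _ d_ (fun x y => y <= x)); apply; first exact: lexx.
    by move=> x y z xy yz; apply: le_trans xy.
  by move=> k; have [_ [_ []]] := mono k.
have gQ' n : [/\ A <= a_ n, a_ n < b_ n, b_ n <= B & [/\ C <= c_ n, c_ n < d_ n & d_ n <= D]].
  by have := gQ n; rewrite QE => -[].
have abnm n m : a_ n <= b_ m.
  rewrite (le_trans (mon_a n (maxn n m) (leq_maxl _ _))) //.
  rewrite (le_trans _ (mon_b m (maxn n m) (leq_maxr _ _))) //.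
  by have [_ /ltW] := gQ' (maxn n m).
have cdnm n m : c_ n <= d_ m.
  rewrite (le_trans (mon_c n (maxn n m) (leq_maxl _ _))) //.
  rewrite (le_trans _ (mon_d m (maxn n m) (leq_maxr _ _))) //.
  by have [_ _ _ [_ /ltW]] := gQ' (maxn n m).
pose x0 := sup (range a_); pose y0 := sup (range c_).
have ax0 n : a_ n <= x0.
  apply: ub_le_sup; last by exists n.
  by exists (b_ 0%N) => _ [m _ <-].
have cy0 n : c_ n <= y0.
  apply: ub_le_sup; last by exists n.
  by exists (d_ 0%N) => _ [m _ <-].
have x0b n : x0 <= b_ n.
  by apply: sup_le_ub; [exists (a_ 0%N), 0%N|move=> _ [m _ <-]].
have y0d n : y0 <= d_ n.
  by apply: sup_le_ub; [exists (c_ 0%N), 0%N|move=> _ [m _ <-]].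
have x0i : A <= x0 <= B by rewrite (ax0 0%N) (x0b 0%N).
have y0i : C <= y0 <= D by rewrite (cy0 0%N) (y0d 0%N).
have W0 : 0 < B - A by lra.
have H0 : 0 < D - C by lra.
have [dl dl0 K] := loopint_small x0i y0i W0 H0 e0.
have [n hn] : exists n, 2^-1 ^+ n <= dl.
  have /cvgrPdist_le/(_ _ dl0)[N _ /(_ N (leqnn N))] :=
    @cvg_expr R 2^-1 ltac:(rewrite ger0_norm; lra).
  rewrite sub0r normrN ger0_norm ?exprn_ge0 ?invr_ge0 //.
  by exists N.
have [s1 s2] := sz n; have [g1 g2 g3 [g4 g5 g6]] := gQ' n.
have := gQ n; rewrite QE => -[_].
rewrite ltNge => /negP; apply.
apply: (K _ _ _ _ (2^-1 ^+ n)) => //.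
- by rewrite g1 ax0.
- by rewrite x0b.
- by rewrite g4 cy0.
- by rewrite y0d.
- by rewrite exprn_gt0 // invr_gt0.
Qed.

End closed_form.

End Goursat.
(** * Cauchy's estimate for the derivative *)

Section ComplexNorm.
Variable R : realType.
Local Notation C := (Cx R).
Implicit Types (z w : C).
Local Open Scope complex_scope.

Definition cnorm z : R := complex.Re `|z|.

Lemma cnormE z : `|z| = (cnorm z)%:C.
Proof. by rewrite /cnorm normc_def. Qed.

Lemma cnorm_sqrt z : cnorm z = Num.sqrt (complex.Re z ^+ 2 + complex.Im z ^+ 2).
Proof. by rewrite /cnorm normc_def. Qed.

Lemma cnorm_sqr z : cnorm z ^+ 2 = complex.Re z ^+ 2 + complex.Im z ^+ 2.
Proof. by rewrite cnorm_sqrt sqr_sqrtr // addr_ge0 // sqr_ge0. Qed.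

Lemma cnorm_ge0 z : 0 <= cnorm z.
Proof. by rewrite cnorm_sqrt sqrtr_ge0. Qed.

Lemma cnorm_real (x : R) : cnorm x%:C = `|x|.
Proof. by rewrite cnorm_sqrt /= expr0n addr0 sqrtr_sqr. Qed.

Lemma cnorm0 : cnorm 0 = 0.
Proof. by rewrite /cnorm normr0. Qed.

Lemma cnormM z w : cnorm (z * w) = cnorm z * cnorm w.
Proof. by apply: (@complexI R); rewrite rmorphM /= -!cnormE normrM. Qed.

Lemma cnormN z : cnorm (- z) = cnorm z.
Proof. by rewrite /cnorm normrN. Qed.

Lemma cnormV z : cnorm z^-1 = (cnorm z)^-1.
Proof. by apply: (@complexI R); rewrite fmorphV /= -!cnormE normfV. Qed.

Lemma cnormD z w : cnorm (z + w) <= cnorm z + cnorm w.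
Proof. by rewrite -lecR rmorphD /= -!cnormE ler_normD. Qed.

Lemma cnorm_eq0 z : (cnorm z == 0) = (z == 0).
Proof. by rewrite -(inj_eq (@complexI R)) -cnormE normr_eq0. Qed.

Lemma cnorm_gt0 z : (0 < cnorm z) = (z != 0).
Proof. by rewrite lt_def cnorm_eq0 cnorm_ge0 andbT. Qed.

Lemma ler_Re_cnorm z : `|complex.Re z| <= cnorm z.
Proof. by rewrite cnorm_sqrt -sqrtr_sqr ler_wsqrtr // lerDl sqr_ge0. Qed.

Lemma ler_Im_cnorm z : `|complex.Im z| <= cnorm z.
Proof. by rewrite cnorm_sqrt -sqrtr_sqr ler_wsqrtr // lerDr sqr_ge0. Qed.

Lemma cnorm_le_ReIm z : cnorm z <= `|complex.Re z| + `|complex.Im z|.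
Proof.
rewrite -ler_sqr ?nnegrE ?cnorm_ge0 ?addr_ge0 //.
by rewrite cnorm_sqr sqrrD !real_normK ?num_real // lerD2r lerDl mulrn_wge0 // mulr_ge0.
Qed.

Lemma cnormJ z : cnorm (z^*) = cnorm z.
Proof. by rewrite /cnorm normcJ. Qed.

Lemma mul_conjc z : z^* * z = ((cnorm z) ^+ 2)%:C.
Proof. by rewrite mulrC -sqr_normc rmorphXn /= -cnormE. Qed.

Lemma ReD z w : complex.Re (z + w) = complex.Re z + complex.Re w.
Proof. by case: z w => [a b] []. Qed.

Lemma ImD z w : complex.Im (z + w) = complex.Im z + complex.Im w.
Proof. by case: z w => [a b] []. Qed.

Lemma ReN z : complex.Re (- z) = - complex.Re z.
Proof. by case: z. Qed.

Lemma ImN z : complex.Im (- z) = - complex.Im z.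
Proof. by case: z. Qed.

Lemma ReM z w : complex.Re (z * w) =
  complex.Re z * complex.Re w - complex.Im z * complex.Im w.
Proof. by case: z w => [a b] []. Qed.

Lemma ImM z w : complex.Im (z * w) =
  complex.Re z * complex.Im w + complex.Im z * complex.Re w.
Proof. by case: z w => [a b] []. Qed.

Lemma Cx_gt0 (e : C) : 0 < e -> e = (complex.Re e)%:C /\ 0 < complex.Re e.
Proof. by case: e => a b; rewrite ltcE /= => /andP[/eqP -> ->]. Qed.

Lemma near_cnorm z (A : set C) : nbhs z A <->
  exists2 dl : R, 0 < dl & forall w, cnorm (w - z) < dl -> A w.
Proof.
split=> [[e /= /Cx_gt0[-> e0] H]|[dl dl0 H]].
  exists (complex.Re e) => // w hw; apply: H.
  by rewrite /= /ball_ distrC cnormE ltcR.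
exists dl%:C; first by rewrite /= ltcR.
by move=> w; rewrite /= /ball_ distrC cnormE ltcR; apply: H.
Qed.

Definition cderiv (f : C -> C) z c := forall e : R, 0 < e ->
  exists2 dl : R, 0 < dl & forall w, cnorm (w - z) < dl ->
  cnorm (f w - f z - c * (w - z)) <= e * cnorm (w - z).

Lemma derivable_cderiv (f : C -> C) z : derivable f z 1 -> cderiv f z ('D_1 f z).
Proof.
move=> df e e0.
have := df; rewrite /derivable => /cvg_ex[l fl].
have El : 'D_1 f z = l by apply/cvg_lim.
rewrite El; move/cvgrPdist_le: fl => /(_ e%:C); rewrite ltcR => /(_ e0).
rewrite near_withinE => /near_cnorm[dl dl0 H]; exists dl => // w hw.
have [->|wz] := eqVneq w z; first by rewrite !subrr mulr0 subrr cnorm0 mulr0.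
have wz0 : w - z != 0 by rewrite subr_eq0.
have := H (w - z); rewrite subr0 => /(_ hw wz0).
rewrite /GRing.scale /= mulr1 subrK cnormE lecR -cnormN opprB => H1.
have -> : f w - f z - l * (w - z) = ((w - z)^-1 * (f w - f z) - l) * (w - z).
  by rewrite mulrBl mulrAC mulVf // mul1r.
by rewrite cnormM ler_wpM2r // cnorm_ge0.
Qed.

End ComplexNorm.

Section HasGrad.
Variable R : realType.
Implicit Types (P S : R -> R -> R) (x y p q d : R).

Lemma has_grad_lip P x y p q : has_grad P x y p q -> exists2 dl, 0 < dl &
  forall u v, `|u - x| <= dl -> `|v - y| <= dl ->
  `|P u v - P x y| <= (`|p| + `|q| + 1) * (`|u - x| + `|v - y|).
Proof.
move=> /(_ 1 ltr01)[dl dl0 H]; exists dl => // u v hu hv.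
have := H u v hu hv; rewrite mul1r => K.
have -> : P u v - P x y = (P u v - P x y - p * (u - x) - q * (v - y))
  + (p * (u - x) + q * (v - y)) by ring.
rewrite (le_trans (ler_normD _ _)) // [in X in _ <= X]mulrDl mul1r addrC lerD //.
rewrite (le_trans (ler_normD _ _)) // !normrM mulrDl !mulrDr.
by rewrite -!addrA lerD2l addrA lerDr addr_ge0 // mulr_ge0.
Qed.

Lemma has_grad1 (g : R -> R) x y d : is_derive x 1 g d ->
  has_grad (fun u _ => g u) x y d 0.
Proof.
move=> [dg Eg] e e0; move: dg; rewrite /derivable => /cvg_ex[l gl].
have {}El : d = l by rewrite -Eg; apply/cvg_lim.
rewrite El; move/cvgrPdist_le: gl => /(_ e e0).
rewrite near_withinE => -[dl /= dl0 H]; exists (dl / 2); first by rewrite divr_gt0.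
move=> u v hu _; rewrite mul0r subr0 [X in _ <= X]mulrDr.
rewrite (@le_trans _ _ (e * `|u - x|)) //; last by rewrite lerDl mulr_ge0 // ltW.
have [->|ux] := eqVneq u x; first by rewrite !subrr mulr0 subrr normr0 mulr0.
have ux0 : u - x != 0 by rewrite subr_eq0.
have := H (u - x); rewrite /ball_ /= sub0r normrN => /(_ _ ux0).
rewrite /GRing.scale /= mulr1 subrK => H1.
have -> : g u - g x - l * (u - x) = ((u - x)^-1 * (g u - g x) - l) * (u - x).
  by rewrite mulrBl mulrAC mulVf // mul1r.
rewrite normrM ler_wpM2r // distrC H1 // (le_lt_trans hu) //.
by rewrite ltr_pdivrMr // ltr_pMr // ltr1n.
Qed.

Lemma has_gradM P S x y p q p' q' : has_grad P x y p q -> has_grad S x y p' q' ->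
  has_grad (fun u v => P u v * S u v) x y
    (p * S x y + P x y * p') (q * S x y + P x y * q').
Proof.
move=> gP gS e e0.
have [d1 d10 L1] := has_grad_lip gP; have [d2 d20 L2] := has_grad_lip gS.
set K1 := _ + 1 in L1; set K2 := _ + 1 in L2.
have K10 : 0 < K1 by rewrite ltr_wpDl ?addr_ge0.
have K20 : 0 < K2 by rewrite ltr_wpDl ?addr_ge0.
pose a := e / 3 / (`|P x y| + 1); pose b := e / 3 / (`|S x y| + 1).
have P10 : 0 < `|P x y| + 1 by rewrite ltr_wpDl.
have S10 : 0 < `|S x y| + 1 by rewrite ltr_wpDl.
have a0 : 0 < a by rewrite !divr_gt0.
have b0 : 0 < b by rewrite !divr_gt0.
have [d3 d30 H3] := gP _ b0; have [d4 d40 H4] := gS _ a0.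
pose d5 := e / 3 / (K1 * K2) / 2.
have d50 : 0 < d5 by rewrite !divr_gt0 // mulr_gt0.
exists (Num.min (Num.min d1 d2) (Num.min (Num.min d3 d4) d5)).
  by rewrite !lt_min d10 d20 d30 d40.
move=> u v; rewrite !le_min => /andP[/andP[u1 u2] /andP[/andP[u3 u4] u5]].
move=> /andP[/andP[v1 v2] /andP[/andP[v3 v4] v5]].
have := L1 u v u1 v1; have := L2 u v u2 v2; have := H3 u v u3 v3; have := H4 u v u4 v4.
set t := `|u - x| + `|v - y| => h4 h3 l2 l1.
have t0 : 0 <= t by rewrite addr_ge0.
have -> : P u v * S u v - P x y * S x y - (p * S x y + P x y * p') * (u - x) -
    (q * S x y + P x y * q') * (v - y) =
  P x y * (S u v - S x y - p' * (u - x) - q' * (v - y)) +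
  S x y * (P u v - P x y - p * (u - x) - q * (v - y)) +
  (P u v - P x y) * (S u v - S x y) by ring.
have -> : e * t = e / 3 * t + e / 3 * t + e / 3 * t by field.
rewrite (le_trans (ler_normD _ _)) // lerD //.
  rewrite (le_trans (ler_normD _ _)) // lerD // normrM.
    have -> : e / 3 = (`|P x y| + 1) * a by rewrite /a; field; rewrite gt_eqF.
    by rewrite -mulrA ler_pM // lerDl.
  have -> : e / 3 = (`|S x y| + 1) * b by rewrite /b; field; rewrite gt_eqF.
  by rewrite -mulrA ler_pM // lerDl.
rewrite normrM (le_trans (ler_pM _ _ l1 l2)) //.
rewrite mulrACA mulrA ler_wpM2r //.
rewrite mulrC -ler_pdivlMr ?mulr_gt0 // /t.
rewrite (le_trans (lerD u5 v5)) // /d5 -splitr //.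
Qed.

End HasGrad.

Section Polar.
Variable R : realType.
Local Notation C := (Cx R).
Local Open Scope complex_scope.

Lemma has_grad_chain (f : C -> C) (X Y : R -> R -> R) x y p q p' q' (c : C) :
  cderiv f (X x y +i* Y x y) c -> has_grad X x y p q -> has_grad Y x y p' q' ->
  has_grad (fun u v => complex.Re (f (X u v +i* Y u v))) x y
    (complex.Re c * p - complex.Im c * p') (complex.Re c * q - complex.Im c * q').
Proof.
move=> df gX gY e e0.
have [d1 d10 L1] := has_grad_lip gX; have [d2 d20 L2] := has_grad_lip gY.
set K1 := _ + 1 in L1; set K2 := _ + 1 in L2.
have K10 : 0 < K1 by rewrite ltr_wpDl ?addr_ge0.
have K20 : 0 < K2 by rewrite ltr_wpDl ?addr_ge0.
have K0 : 0 < K1 + K2 by rewrite addr_gt0.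
have e20 : 0 < e / 2 by rewrite divr_gt0.
have e30 : 0 < e / 2 / (K1 + K2) by rewrite divr_gt0.
have [d3 d30 H3] := df _ e30.
pose N := `|complex.Re c| + `|complex.Im c| + 1.
have N0 : 0 < N by rewrite ltr_wpDl ?addr_ge0.
have e40 : 0 < e / 2 / N by rewrite divr_gt0.
have [d4 d40 H4] := gX _ e40; have [d5 d50 H5] := gY _ e40.
pose d6 := d3 / (K1 + K2) / 4.
have d60 : 0 < d6 by rewrite !divr_gt0.
exists (Num.min (Num.min d1 d2) (Num.min (Num.min d4 d5) d6)).
  by rewrite !lt_min d10 d20 d40 d50.
move=> u v; rewrite !le_min => /andP[/andP[u1 u2] /andP[/andP[u4 u5] u6]].
move=> /andP[/andP[v1 v2] /andP[/andP[v4 v5] v6]].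
have := L1 u v u1 v1; have := L2 u v u2 v2; have := H4 u v u4 v4; have := H5 u v u5 v5.
set t := `|u - x| + `|v - y| => h5 h4 l2 l1.
have t0 : 0 <= t by rewrite addr_ge0.
pose w : C := X u v +i* Y u v; pose w0 : C := X x y +i* Y x y.
have wl : cnorm (w - w0) <= (K1 + K2) * t.
  by rewrite (le_trans (cnorm_le_ReIm _)) // mulrDl lerD.
have := H3 w; have -> : cnorm (w - w0) < d3.
  rewrite (le_lt_trans wl) // mulrC -ltr_pdivlMr //.
  rewrite (le_lt_trans (lerD u6 v6)) // /d6 -mulrDr.
  rewrite gtr_pMr ?divr_gt0 //; lra.
move=> /(_ isT) h3.
pose E := f w - f w0 - c * (w - w0).
have -> : complex.Re (f w) - complex.Re (f w0)
   - (complex.Re c * p - complex.Im c * p') * (u - x)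
   - (complex.Re c * q - complex.Im c * q') * (v - y) =
   complex.Re E + (complex.Re c * (X u v - X x y - p * (u - x) - q * (v - y))
     - complex.Im c * (Y u v - Y x y - p' * (u - x) - q' * (v - y))).
  by rewrite /E !(ReD, ReN, ReM, ImD, ImN) /=; ring.
rewrite [in X in _ <= X](splitr e) mulrDl (le_trans (ler_normD _ _)) // lerD //.
  rewrite (le_trans (ler_Re_cnorm _)) // (le_trans h3) //.
  rewrite -ler_pdivlMl // (le_trans wl) // le_eqVlt; apply/orP; left; apply/eqP.
  by field; rewrite !gt_eqF.
rewrite (le_trans (ler_normB _ _)) // !normrM.
have -> : e / 2 * t = N * (e / 2 / N * t) by field; rewrite gt_eqF.
rewrite (@le_trans _ _ (`|complex.Re c| * (e / 2 / N * t) + `|complex.Im c| * (e / 2 / N * t))) //.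
  by rewrite lerD // ler_wpM2l.
by rewrite -mulrDl ler_wpM2r ?lerDl // mulr_ge0 // ltW.
Qed.

Definition cis (t : R) : C := cos t +i* sin t.

Lemma cnorm_cis t : cnorm (cis t) = 1.
Proof. by rewrite cnorm_sqrt /= cos2Dsin2 sqrtr1. Qed.

Let X (x t : R) := expR x * cos t.
Let Y (x t : R) := expR x * sin t.
Let polarE x t : X x t +i* Y x t = (expR x)%:C * cis t.
Proof. by apply/eqP; rewrite eq_complex /= !mul0r subr0 addr0 !eqxx. Qed.

Let gX x t : has_grad X x t (X x t) (- Y x t).
Proof.
have g1 := has_grad1 t (is_derive_expR x).
have g2 := has_grad_sym (has_grad1 x (is_derive_cos t)).
have := has_gradM g1 g2.
by rewrite mulr0 mul0r addr0 add0r mulrN.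
Qed.

Let gY x t : has_grad Y x t (Y x t) (X x t).
Proof.
have g1 := has_grad1 t (is_derive_expR x).
have g2 := has_grad_sym (has_grad1 x (is_derive_sin t)).
have := has_gradM g1 g2.
by rewrite mulr0 mul0r addr0 add0r.
Qed.

(** In the coordinates x = log |z| and t = arg z, the real part of q (z) dz / (i z)
    is Re q dt + Im q dx. It is closed by the Cauchy-Riemann equations, and the
    sides t = 0 and t = 2 pi of the rectangle cancel by periodicity. *)
Lemma circle_mean_indep (q : C -> C) (c : C -> C) (r x1 x2 : R) :
  (forall z, z != 0 -> cnorm z < r -> cderiv q z (c z)) ->
  x1 < x2 -> expR x2 < r ->
  segint 0 (2 * pi) (fun t => complex.Re (q ((expR x1)%:C * cis t))) =
  segint 0 (2 * pi) (fun t => complex.Re (q ((expR x2)%:C * cis t))).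
Proof.
move=> dq x12 x2r.
pose S x t := complex.Re (q (X x t +i* Y x t)).
(* the imaginary part of q is the real part of - i q *)
pose P x t := complex.Re (- 'i%C * q (X x t +i* Y x t)).
have dz x t : x1 <= x <= x2 ->
    cderiv q (X x t +i* Y x t) (c (X x t +i* Y x t)).
  move=> /andP[_ xx2].
  have N : cnorm (X x t +i* Y x t : C) = expR x.
    by rewrite polarE cnormM cnorm_cis mulr1 cnorm_real ger0_norm ?expR_ge0.
  apply: dq; first by rewrite -cnorm_gt0 N expR_gt0.
  by rewrite N (le_lt_trans _ x2r) // ler_expR.
pose a x t := complex.Re (c (X x t +i* Y x t)).
pose b x t := complex.Im (c (X x t +i* Y x t)).
have gS x t : x1 <= x <= x2 -> 0 <= t <= 2 * pi ->
    has_grad S x t (a x t * X x t - b x t * Y x t) (a x t * - Y x t - b x t * X x t).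
  by move=> /dz h _; apply: (has_grad_chain (h t) (gX x t) (gY x t)).
have gP x t : x1 <= x <= x2 -> 0 <= t <= 2 * pi ->
    has_grad P x t (b x t * X x t + a x t * Y x t) (a x t * X x t - b x t * Y x t).
  move=> /dz h _.
  have h2 : cderiv (fun z => - 'i%C * q z) (X x t +i* Y x t)
     (- 'i%C * c (X x t +i* Y x t)).
    move=> e /(h t)[dl dl0 H]; exists dl => // w /H.
    rewrite -!mulrA -!mulrBr cnormM cnormN.
    by rewrite [cnorm 'i%C]cnorm_sqrt /= expr0n expr1n add0r sqrtr1 mul1r.
  have := has_grad_chain h2 (gX x t) (gY x t).
  rewrite !(ReM, ImM, ReN, ImN) /=.
  by congr has_grad; rewrite /a /b; ring.
have := goursat gP gS x12 (mulr_gt0 (ltr0n R 2) (pi_gt0 R)).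
rewrite /loopint.
have -> : segint x1 x2 (P ^~ 0) = segint x1 x2 (P ^~ (2 * pi)).
  apply: eq_Rintegral => x _; rewrite /P /X /Y.
  by rewrite mulr_natl cos2pi sin2pi cos0 sin0.
rewrite subrr add0r => /eqP; rewrite subr_eq0 => /eqP E.
rewrite (_ : (fun t => _) = S x1); last first.
  by apply/funext => t; rewrite /S polarE.
by rewrite -E; apply: eq_Rintegral => x _; rewrite /S polarE.
Qed.

Lemma circle_continuous (q : C -> C) (c : C) (x t : R) :
  cderiv q ((expR x)%:C * cis t) c ->
  {for t, continuous (fun t => complex.Re (q ((expR x)%:C * cis t)))}.
Proof.
rewrite -polarE => dq.
have := has_grad_cont2 (has_grad_chain dq (gX x t) (gY x t)).
by under [X in {for _, continuous X}]eq_fun => u do rewrite polarE.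
Qed.

(** All means over circles are equal, and those over small circles tend to L. *)
Lemma circle_mean_Re (q c : C -> C) (r rho M : R) (L : C) :
  (forall z, z != 0 -> cnorm z < r -> cderiv q z (c z)) -> 0 < rho < r ->
  (forall e, 0 < e -> exists2 dl, 0 < dl &
     forall z, z != 0 -> cnorm z < dl -> cnorm (q z - L) <= e) ->
  (forall z, cnorm z = rho -> cnorm (q z) <= M) -> `|complex.Re L| <= M.
Proof.
move=> dq /andP[rho0 rhor] qL qM; apply/ler_addgt0Pr => e e0.
have [dl dl0 H] := qL e e0.
pose x2 := ln rho; have Ex2 : expR x2 = rho by rewrite lnK.
pose m := Num.min dl rho / 2.
have mn0 : 0 < Num.min dl rho by rewrite lt_min dl0.
have m0 : 0 < m by rewrite divr_gt0.
have mm : m < Num.min dl rho by rewrite ltr_pdivrMr // ltr_pMr // ltr1n.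
pose x1 := ln m; have Ex1 : expR x1 = m by rewrite lnK.
move: mm; rewrite lt_min => /andP[mdl mrho].
have x12 : x1 < x2 by rewrite -ltr_expR Ex1 Ex2.
have N x t : cnorm ((expR x)%:C * cis t) = expR x.
  by rewrite cnormM cnorm_cis mulr1 cnorm_real ger0_norm ?expR_ge0.
have N0 x t : (expR x)%:C * cis t != 0 by rewrite -cnorm_gt0 N expR_gt0.
have Ct x : expR x < r -> {in `[0, 2 * pi], continuous (fun t => complex.Re (q ((expR x)%:C * cis t)))}.
  move=> xr t _; apply: (@circle_continuous _ (c ((expR x)%:C * cis t))).
  by apply: dq => //; rewrite N.
have pi20 : 0 < 2 * pi :> R by rewrite mulr_gt0 // pi_gt0.
have Er1 : expR x1 < r by rewrite Ex1 (lt_trans mrho).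
have Er2 : expR x2 < r by rewrite Ex2.
have := segint_bound (k := complex.Re L) (e := M + e) (ltW pi20) (Ct _ Er1) (Ct _ Er2).
rewrite (circle_mean_indep dq x12 Er2) subrr sub0r normrN normrM subr0.
rewrite (gtr0_norm pi20) ler_pM2r //; apply => t _.
rewrite addrAC (le_trans (ler_normB _ _)) // [M + e]addrC lerD //.
  rewrite -ReN -ReD (le_trans (ler_Re_cnorm _)) // H //.
  by rewrite N Ex1.
by rewrite (le_trans (ler_Re_cnorm _)) // qM // N.
Qed.

(** Rotate L to the positive real axis: the statement for real parts is applied
    to conj L * q. *)
Lemma circle_mean_bound (q c : C -> C) (r rho M : R) (L : C) :
  (forall z, z != 0 -> cnorm z < r -> cderiv q z (c z)) -> 0 < rho < r ->
  (forall e, 0 < e -> exists2 dl, 0 < dl &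
     forall z, z != 0 -> cnorm z < dl -> cnorm (q z - L) <= e) ->
  (forall z, cnorm z = rho -> cnorm (q z) <= M) -> cnorm L <= M.
Proof.
move=> dq rr qL qM.
have [->|L0] := eqVneq L 0.
  rewrite cnorm0; move: rr => /andP[rho0 _].
  have := qM rho%:C; rewrite cnorm_real gtr0_norm // => /(_ erefl).
  exact: le_trans (cnorm_ge0 _).
have nL : 0 < cnorm L by rewrite cnorm_gt0.
have := @circle_mean_Re (fun z => L^* * q z) (fun z => L^* * c z) r rho
  (cnorm L * M) (L^* * L).
rewrite mul_conjc /= ger0_norm ?sqr_ge0 // expr2 ler_pM2l //; apply => //.
- move=> z z0 zr e e0; have e1 : 0 < e / cnorm L by rewrite divr_gt0.
  have [dl dl0 H] := dq z z0 zr _ e1; exists dl => // w /H.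
  rewrite -!mulrA -!mulrBr cnormM cnormJ => H1.
  apply: (le_trans (ler_wpM2l (cnorm_ge0 L) H1)).
  by rewrite mulrCA mulVKf // gt_eqF.
- move=> e e0; have e1 : 0 < e / cnorm L by rewrite divr_gt0.
  have [dl dl0 H] := qL _ e1; exists dl => // z z0 /(H _ z0).
  by rewrite -expr2 -mul_conjc -mulrBr cnormM cnormJ ler_pdivlMr // mulrC.
- by move=> z /qM; rewrite cnormM cnormJ ler_pM2l.
Qed.

(** The difference quotient (f (z) - f (0)) / z tends to f' (0) at 0 and is
    bounded by M / rho on the circle of radius rho, for each rho < r. *)
Lemma cauchy_estimate (f : C -> C) (r M : R) : 0 < r ->
  (forall z, cnorm z < r -> derivable f z 1) ->
  (forall z, cnorm z < r -> cnorm (f z - f 0) <= M) ->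
  cnorm ('D_1 f 0) * r <= M.
Proof.
move=> r0 df fM.
have M0 : 0 <= M by apply: le_trans (fM 0 _); rewrite ?cnorm_ge0 // cnorm0.
have key rho : 0 < rho < r -> cnorm ('D_1 f 0) * rho <= M.
  move=> rr; have /andP[rho0 rhor] := rr.
  rewrite -ler_pdivlMr //.
  pose q z := (f z - f 0) * z^-1.
  apply: (@circle_mean_bound q ('D_1 q) r rho).
  - move=> z z0 zr; apply: derivable_cderiv; apply: derivableM.
      by apply: derivableB; [exact: df|exact: derivable_cst].
    by apply: derivableV => //; exact: derivable_id.
  - by [].
  - have d0 : derivable f 0 1 by apply: df; rewrite cnorm0.
    move=> e /(derivable_cderiv d0)[dl dl0 H]; exists dl => // z z0 zd.
    have := H z; rewrite subr0 => /(_ zd) H1.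
    have -> : q z - 'D_1 f 0 = (f z - f 0 - 'D_1 f 0 * z) * z^-1.
      by rewrite mulrBl mulfK.
    by rewrite cnormM cnormV ler_pdivrMr ?cnorm_gt0.
  - move=> z zr; rewrite cnormM cnormV zr ler_wpM2r ?invr_ge0 ?(ltW rho0) //.
    by rewrite fM // zr.
have [->|c0] := eqVneq (cnorm ('D_1 f 0)) 0; first by rewrite mul0r.
have {}c0 : 0 < cnorm ('D_1 f 0) by rewrite lt_def c0 cnorm_ge0.
rewrite -ler_pdivlMl // leNgt; apply/negP => big.
have [l1 l2] := midf_lt big.
have s0 : 0 <= (cnorm ('D_1 f 0))^-1 * M by rewrite mulr_ge0 // invr_ge0 cnorm_ge0.
have := key (((cnorm ('D_1 f 0))^-1 * M + r) / 2).
rewrite l2 (le_lt_trans s0 l1) => /(_ isT).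
by rewrite -ler_pdivlMl // leNgt l1.
Qed.

End Polar.
(** * The Euclidean norm of C^k and the differential *)

Lemma subrACA (W : zmodType) (a b c d : W) : a - b - (c - d) = a - c - (b - d).
Proof. by rewrite !opprD !opprK addrACA. Qed.

Section EuclideanNorm.
Variables (R : realType) (k : nat).
Local Notation C := (Cx R).
Local Notation V := 'rV[C]_k.
Implicit Types (z w u v : V) (A B : 'M[C]_k).
Local Open Scope complex_scope.

Lemma enorm_sqr z : enorm z ^+ 2 = \sum_(j < k) cnorm (z ord0 j) ^+ 2.
Proof.
rewrite sqr_sqrtr; first by apply: eq_bigr => j _; rewrite cnorm_sqr.
by apply: sumr_ge0 => j _; rewrite addr_ge0 // sqr_ge0.
Qed.

Lemma enorm_ge0 z : 0 <= enorm z.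
Proof. exact: sqrtr_ge0. Qed.

Lemma cnorm_le_enorm z j : cnorm (z ord0 j) <= enorm z.
Proof.
rewrite -ler_sqr ?nnegrE ?cnorm_ge0 ?enorm_ge0 // enorm_sqr (bigD1 j) //=.
by rewrite lerDl sumr_ge0 // => i _; rewrite sqr_ge0.
Qed.

Lemma enorm_eq0 z : (enorm z == 0) = (z == 0).
Proof.
apply/eqP/eqP => [z0|->]; last first.
  by apply/eqP; rewrite -sqrf_eq0 enorm_sqr big1 // => j _; rewrite mxE cnorm0 expr0n.
apply/rowP => j; rewrite mxE; apply/eqP; rewrite -cnorm_eq0 eq_le cnorm_ge0 andbT.
by rewrite -z0 cnorm_le_enorm.
Qed.

Lemma enorm0 : enorm (0 : V) = 0.
Proof. by apply/eqP; rewrite enorm_eq0. Qed.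

Lemma enorm_gt0 z : (0 < enorm z) = (z != 0).
Proof. by rewrite lt_def enorm_eq0 enorm_ge0 andbT. Qed.

Lemma enormZ (c : C) z : enorm (c *: z) = cnorm c * enorm z.
Proof.
apply/eqP; rewrite -(@eqrXn2 _ 2) ?mulr_ge0 ?enorm_ge0 ?cnorm_ge0 //.
rewrite exprMn !enorm_sqr mulr_sumr; apply/eqP/eq_bigr => j _.
by rewrite mxE cnormM exprMn.
Qed.

Lemma enormN z : enorm (- z) = enorm z.
Proof. by rewrite -scaleN1r enormZ cnormN -[1]/(1%:C) cnorm_real normr1 mul1r. Qed.

Definition dotc u w : C := \sum_(j < k) u ord0 j * (w ord0 j)^*.

Lemma dotcDl u v w : dotc (u + v) w = dotc u w + dotc v w.
Proof. by rewrite -big_split /=; apply: eq_bigr => j _; rewrite mxE mulrDl. Qed.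

Lemma dotcZl (c : C) u w : dotc (c *: u) w = c * dotc u w.
Proof. by rewrite mulr_sumr; apply: eq_bigr => j _; rewrite mxE mulrA. Qed.

Lemma dotcNl u w : dotc (- u) w = - dotc u w.
Proof. by rewrite -scaleN1r dotcZl mulN1r. Qed.

Lemma dotcBl u v w : dotc (u - v) w = dotc u w - dotc v w.
Proof. by rewrite dotcDl dotcNl. Qed.

Lemma dotcc w : dotc w w = (enorm w ^+ 2)%:C.
Proof.
rewrite enorm_sqr rmorph_sum; apply: eq_bigr => j _.
by rewrite mulrC mul_conjc.
Qed.

Lemma cauchy_schwarz u w : cnorm (dotc u w) <= enorm u * enorm w.
Proof.
have [->|u0] := eqVneq u 0.
  by rewrite /dotc big1 ?cnorm0 ?mulr_ge0 ?enorm_ge0 // => j _; rewrite mxE mul0r.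
have [->|w0] := eqVneq w 0.
  by rewrite /dotc big1 ?cnorm0 ?mulr_ge0 ?enorm_ge0 // => j _; rewrite mxE [X in _ * X](@conjc0 R) mulr0.
rewrite -!enorm_gt0 in u0 w0.
set a := enorm u in u0 *; set b := enorm w in w0 *.
have cnorm_sum (F : 'I_k -> C) : cnorm (\sum_j F j) <= \sum_j cnorm (F j).
  elim/big_ind2 : _ => //; first by rewrite cnorm0.
  by move=> x1 x2 y1 y2 h1 h2; rewrite (le_trans (cnormD _ _)) // lerD.
rewrite (le_trans (cnorm_sum _)) //.
have amgm (x y : R) : x * y <= (x ^+ 2 * (b / a) + y ^+ 2 * (a / b)) / 2.
  rewrite -subr_ge0.
  have -> : (x ^+ 2 * (b / a) + y ^+ 2 * (a / b)) / 2 - x * y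
     = (x * b - y * a) ^+ 2 / (2 * a * b) by field; rewrite !gt_eqF.
  by rewrite divr_ge0 ?sqr_ge0 // ltW // !mulr_gt0.
apply: (@le_trans _ _ (\sum_j (cnorm (u ord0 j) ^+ 2 * (b / a)
    + cnorm (w ord0 j) ^+ 2 * (a / b)) / 2)).
  by apply: ler_sum => j _; rewrite cnormM cnormJ amgm.
rewrite -mulr_suml big_split /= -!mulr_suml -!enorm_sqr -/a -/b le_eqVlt.
by apply/orP; left; apply/eqP; field; rewrite !gt_eqF.
Qed.

Lemma enormD u v : enorm (u + v) <= enorm u + enorm v.
Proof.
have [->|uv0] := eqVneq (u + v) 0; first by rewrite enorm0 addr_ge0 // enorm_ge0.
rewrite -enorm_gt0 in uv0; rewrite -(ler_pM2r uv0) -expr2.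
have -> : enorm (u + v) ^+ 2 = cnorm (dotc (u + v) (u + v)).
  by rewrite dotcc cnorm_real ger0_norm ?sqr_ge0.
rewrite {1}dotcDl mulrDl (le_trans (cnormD _ _)) // lerD // cauchy_schwarz //.
Qed.

Lemma enormB u v : enorm (u - v) <= enorm u + enorm v.
Proof. by rewrite (le_trans (enormD _ _)) // enormN. Qed.

Lemma enorm_sub u v : enorm (u - v) = enorm (v - u).
Proof. by rewrite -enormN opprB. Qed.

Lemma enormB_ge u v : enorm u - enorm v <= enorm (u - v).
Proof. by rewrite lerBlDr (le_trans _ (enormD _ _)) // subrK. Qed.

Lemma enorm_delta j : enorm (delta_mx ord0 j : V) = 1.
Proof.
apply/eqP; rewrite -(@eqrXn2 _ 2) ?enorm_ge0 // enorm_sqr expr1n (bigD1 j) //=.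
rewrite mxE !eqxx big1 ?addr0 => [|i ij].
  by rewrite -[_%:R]/(1%:C) cnorm_real normr1 expr1n.
by rewrite mxE (negbTE ij) andbF cnorm0 expr0n.
Qed.

Lemma enorm_le_sum z : enorm z <= \sum_(j < k) cnorm (z ord0 j).
Proof.
rewrite {1}(row_sum_delta z).
elim/big_ind2 : _ => //; first by rewrite enorm0.
  by move=> x1 x2 y1 y2 h1 h2; rewrite (le_trans (enormD _ _)) // lerD.
by move=> j _; rewrite enormZ enorm_delta mulr1.
Qed.

Lemma mulmx_bounded A : exists2 c : R, 0 <= c & forall z, enorm (z *m A) <= c * enorm z.
Proof.
exists (\sum_(j < k) \sum_(i < k) cnorm (A i j)).
  by do 2!(apply: sumr_ge0 => ? _); exact: cnorm_ge0.
move=> z; rewrite (le_trans (enorm_le_sum _)) // mulr_suml; apply: ler_sum => j _.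
rewrite mxE mulr_suml; elim/big_ind2 : _ => //; first by rewrite cnorm0.
  by move=> x1 x2 y1 y2 h1 h2; rewrite (le_trans (cnormD _ _)) // lerD.
by move=> i _; rewrite cnormM mulrC ler_wpM2l ?cnorm_ge0 // cnorm_le_enorm.
Qed.

Lemma opnorm_has_sup A : has_sup [set enorm (z *m A) | z in [set z | enorm z <= 1]].
Proof.
split; first by exists (enorm (0 *m A)), 0 => //=; rewrite enorm0.
have [c c0 H] := mulmx_bounded A; exists c => _ [z /= z1 <-].
by rewrite (le_trans (H z)) // -[leRHS]mulr1 ler_wpM2l.
Qed.

Lemma opnorm_ge0 A : 0 <= opnorm A.
Proof.
apply: le_trans (ub_le_sup (opnorm_has_sup A).2 _); last by exists 0; rewrite //= enorm0.
exact: enorm_ge0.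
Qed.

Lemma opnormP z A : enorm (z *m A) <= opnorm A * enorm z.
Proof.
have [->|z0] := eqVneq z 0; first by rewrite mul0mx enorm0 mulr0.
rewrite -enorm_gt0 in z0.
rewrite -ler_pdivrMr // mulrC.
have -> : (enorm z)^-1 * enorm (z *m A) = enorm (((enorm z)^-1%:C *: z) *m A).
  by rewrite -scalemxAl enormZ cnorm_real ger0_norm // invr_ge0 enorm_ge0.
apply: (ub_le_sup (opnorm_has_sup A).2); exists ((enorm z)^-1%:C *: z) => //=.
by rewrite enormZ cnorm_real ger0_norm ?invr_ge0 ?enorm_ge0 // mulVf // gt_eqF.
Qed.

Lemma opnorm_le A c : 0 <= c -> (forall z, enorm (z *m A) <= c * enorm z) -> opnorm A <= c.
Proof.
move=> c0 H; apply: sup_le_ub; first exact: (opnorm_has_sup A).1.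
by move=> _ [z /= z1 <-]; rewrite (le_trans (H z)) // -[leRHS]mulr1 ler_wpM2l.
Qed.

Lemma opnormM A B : opnorm (A *m B) <= opnorm A * opnorm B.
Proof.
apply: opnorm_le => [|z]; first by rewrite mulr_ge0 ?opnorm_ge0.
rewrite mulmxA (le_trans (opnormP _ _)) // [opnorm A * _]mulrC -mulrA.
by rewrite ler_wpM2l ?opnorm_ge0 ?opnormP.
Qed.

Lemma opnormZ_le (c : C) A : opnorm (c *: A) <= cnorm c * opnorm A.
Proof.
apply: opnorm_le => [|z]; first by rewrite mulr_ge0 ?opnorm_ge0 ?cnorm_ge0.
by rewrite -scalemxAr enormZ -mulrA ler_wpM2l ?cnorm_ge0 // opnormP.
Qed.

End EuclideanNorm.

Section Differential.
Variables (R : realType) (k : nat).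
Local Notation C := (Cx R).
Local Notation V := 'rV[C]_k.
Implicit Types (z w u v a : V) (A B : 'M[C]_k) (f g : V -> V).
Local Open Scope complex_scope.

Lemma normr_le_enorm z : `|z| <= (enorm z)%:C.
Proof.
have [->|z0] := eqVneq `|z| 0; first by rewrite ler0c enorm_ge0.
have [[i j] /= E] := mx_norm_neq0 z0.
have -> : `|z| = `|z i j| by [].
by rewrite (ord1 i) cnormE lecR cnorm_le_enorm.
Qed.

Lemma normr_coord z j : `|z ord0 j| <= `|z|.
Proof.
rewrite [in leRHS]/Num.Def.normr /= mx_normE.
have -> : `|z ord0 j| = (`|z ord0 j|%:nng)%:num by [].
rewrite num_le.
exact: (le_bigmax _ (fun i : 'I_1 * 'I_k => `|z i.1 i.2|%:nng) (ord0, j)).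
Qed.

Lemma enorm_le_normr z : (enorm z)%:C <= k%:R * `|z|.
Proof.
apply: (@le_trans _ _ (\sum_(j < k) cnorm (z ord0 j))%:C).
  by rewrite lecR enorm_le_sum.
rewrite rmorph_sum /=; apply: (@le_trans _ _ (\sum_(j < k) `|z|)).
  by apply: ler_sum => j _; rewrite -cnormE normr_coord.
by rewrite sumr_const card_ord mulr_natl.
Qed.

Let natr1_complex : k%:R + 1 = (k%:R + 1)%:C :> C.
Proof. by rewrite rmorphD rmorph_nat rmorph1. Qed.

(** The topology of row vectors comes from the sup norm; this is the transfer to
    Euclidean balls through which all limits below are taken. *)
Lemma near_enorm a (S : set V) : nbhs a S <->
  exists2 dl : R, 0 < dl & forall z, enorm (z - a) < dl -> S z.
Proof.
split=> [/nbhs_ballP[e /= /Cx_gt0[-> e0] H]|[dl dl0 H]].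
  exists (complex.Re e) => // z hz; apply: H.
  rewrite -ball_normE /ball_ /= -normrN opprB.
  by rewrite (le_lt_trans (normr_le_enorm _)) // ltcR.
have k0 : 0 < k%:R + 1 :> R by rewrite ltr_wpDl.
apply/nbhs_ballP; exists (dl / (k%:R + 1))%:C; first by rewrite /= ltcR divr_gt0.
move=> z; rewrite -ball_normE /ball_ /= -normrN opprB => hz; apply: H.
rewrite -ltcR (le_lt_trans (enorm_le_normr _)) //.
have -> : dl%:C = (k%:R + 1) * (dl / (k%:R + 1))%:C.
  by rewrite natr1_complex -rmorphM /= mulrC divfK // gt_eqF.
rewrite (@le_lt_trans _ _ ((k%:R + 1) * `|z - a|)) //.
  by rewrite ler_wpM2r // lerDl.
by rewrite ltr_pM2l // ltr_wpDl.
Qed.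

(** Differentiability measured in the Euclidean norm; diff_has_jac and
    has_jac_diff identify it with the topological notion, A being the Jacobian. *)
Definition has_jac f a A := forall e : R, 0 < e -> exists2 dl : R, 0 < dl &
  forall z, enorm (z - a) < dl ->
  enorm (f z - f a - (z - a) *m A) <= e * enorm (z - a).

Lemma diff_has_jac f a : differentiable f a -> has_jac f a ('J f a).
Proof.
move=> df e e0.
have /eqaddoP := diff_locally df.
have k0 : 0 < k%:R + 1 :> R by rewrite ltr_wpDl.
have e10 : 0 < (e / (k%:R + 1))%:C :> C by rewrite ltcR divr_gt0.
move=> /(_ _ e10) /near_enorm[dl dl0 H].
exists dl => // z hz; have := H (z - a); rewrite subr0 => /(_ hz).
rewrite /= !fctE /= subrK mul_rV_lin1 => h.
rewrite -lecR (le_trans (enorm_le_normr _)) //.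
rewrite -addrA -opprD.
apply: (@le_trans _ _ ((k%:R + 1) * ((e / (k%:R + 1))%:C * `|z - a|))).
  rewrite (le_trans (ler_wpM2l _ h)) //.
  by rewrite ler_wpM2r ?lerDl // mulr_ge0 // ltW.
have E : e%:C = (k%:R + 1) * (e / (k%:R + 1))%:C :> C.
  by rewrite natr1_complex -rmorphM /= mulrC divfK // gt_eqF.
rewrite [leRHS]rmorphM /= E -mulrA; apply: ler_wpM2l; first by rewrite addr_ge0.
by apply: ler_wpM2l; rewrite ?normr_le_enorm // ltW.
Qed.

Lemma mulmxr_continuous A : continuous (mulmxr A : V -> V).
Proof.
move=> x S /near_enorm[dl dl0 H]; apply/near_enorm.
have [c c0 Hc] := mulmx_bounded A.
have c1 : 0 < c + 1 by rewrite ltr_wpDl.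
exists (dl / (c + 1)); first by rewrite divr_gt0.
move=> z hz; apply: H; rewrite /= -mulmxBl (le_lt_trans (Hc _)) //.
rewrite (@le_lt_trans _ _ ((c + 1) * enorm (z - x))) //.
  by rewrite ler_wpM2r ?enorm_ge0 // lerDl.
by rewrite mulrC -ltr_pdivlMr.
Qed.

Lemma has_jac_diff f a A : has_jac f a A -> differentiable f a /\ 'J f a = A.
Proof.
move=> H.
have E : f \o shift a = cst (f a) + mulmxr A +o_ (0 : V) id.
  apply/eqaddoP => e /Cx_gt0[-> e0].
  have k0 : 0 < k%:R + 1 :> R by rewrite ltr_wpDl.
  have e10 : 0 < complex.Re e / (k%:R + 1) by rewrite divr_gt0.
  have [dl dl0 K] := H _ e10.
  apply/near_enorm; exists dl => // z; rewrite subr0 => hz.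
  have := K (z + a); rewrite addrK => /(_ hz) h.
  rewrite /= !fctE /= (le_trans (normr_le_enorm _)) // opprD addrA.
  rewrite (@le_trans _ _ (complex.Re e / (k%:R + 1) * enorm z)%:C) ?lecR //.
  rewrite [leLHS]rmorphM /= (le_trans (ler_wpM2l _ (enorm_le_normr z))) //.
    by rewrite ler0c ltW.
  have -> : (complex.Re e)%:C = (k%:R + 1) * (complex.Re e / (k%:R + 1))%:C :> C.
    by rewrite natr1_complex -rmorphM /= mulrC divfK // gt_eqF.
  rewrite mulrCA mulrA ler_wpM2r // ler_wpM2r ?lerDl // ler0c ltW //.
have D := diff_unique (@mulmxr_continuous A) E.
have df : differentiable f a.
  by apply/diff_locallyP; rewrite D; split => //; exact: mulmxr_continuous.
split=> //; apply/row_matrixP => i.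
by rewrite !rowE -[LHS]/(_ *m lin1_mx _) mul_rV_lin1 D.
Qed.

Lemma has_jac_lip f a A : has_jac f a A -> exists2 dl : R, 0 < dl &
  forall z, enorm (z - a) < dl -> enorm (f z - f a) <= (opnorm A + 1) * enorm (z - a).
Proof.
move=> /(_ 1 ltr01)[dl dl0 H]; exists dl => // z /H; rewrite mul1r => h.
rewrite -[f z - f a](subrK ((z - a) *m A)) (le_trans (enormD _ _)) //.
by rewrite mulrDl mul1r addrC lerD // opnormP.
Qed.

Lemma has_jac_cont f a A : has_jac f a A -> forall e : R, 0 < e ->
  exists2 dl : R, 0 < dl & forall z, enorm (z - a) < dl -> enorm (f z - f a) < e.
Proof.
move=> /has_jac_lip[dl dl0 H] e e0.
have c1 : 0 < opnorm A + 1 by rewrite ltr_wpDl ?opnorm_ge0.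
exists (Num.min dl (e / (opnorm A + 1))); first by rewrite lt_min dl0 divr_gt0.
move=> z; rewrite lt_min => /andP[/H h hz].
by rewrite (le_lt_trans h) // mulrC -ltr_pdivlMr.
Qed.

Lemma has_jac_uniq f a A B : has_jac f a A -> has_jac f a B -> A = B.
Proof. by move=> /has_jac_diff[_ <-] /has_jac_diff[_ <-]. Qed.

Lemma has_jac_affine f a A B b : has_jac f (b + a *m B) A ->
  has_jac (fun z => f (b + z *m B)) a (B *m A).
Proof.
move=> H e e0; have [c c0 Hc] := mulmx_bounded B.
have c1 : 0 < c + 1 by rewrite ltr_wpDl.
have Hc1 z : enorm (z *m B) <= (c + 1) * enorm z.
  by rewrite (le_trans (Hc z)) // ler_wpM2r ?enorm_ge0 // lerDl.
have [dl dl0 K] := H (e / (c + 1)) (divr_gt0 e0 c1).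
exists (dl / (c + 1)); first by rewrite divr_gt0.
move=> z hz.
have E : b + z *m B - (b + a *m B) = (z - a) *m B.
  by rewrite opprD addrACA subrr add0r -mulmxBl.
have := K (b + z *m B); rewrite E mulmxA => h.
rewrite (le_trans (h _)) //.
  by rewrite (le_lt_trans (Hc1 _)) // mulrC -ltr_pdivlMr.
by rewrite -mulrA ler_wpM2l ?(ltW e0) // ler_pdivrMl.
Qed.

Lemma has_jac_mulr f a A B : has_jac f a A -> has_jac (fun z => f z *m B) a (A *m B).
Proof.
move=> H e e0; have [c c0 Hc] := mulmx_bounded B.
have c1 : 0 < c + 1 by rewrite ltr_wpDl.
have [dl dl0 K] := H (e / (c + 1)) (divr_gt0 e0 c1); exists dl => // z /K h.
rewrite mulmxA -!mulmxBl (le_trans (Hc _)) //.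
rewrite (@le_trans _ _ ((c + 1) * enorm (f z - f a - (z - a) *m A))) //.
  by rewrite ler_wpM2r ?enorm_ge0 // lerDl.
by rewrite -ler_pdivlMl // mulrA [_^-1 * _]mulrC.
Qed.

Lemma has_jacZ f a A (c : C) : has_jac f a A -> has_jac (fun z => c *: f z) a (c *: A).
Proof.
move=> H; rewrite -mul_mx_scalar.
have -> : (fun z => c *: f z) = (fun z => f z *m c%:M).
  by apply/funext => z; rewrite mul_mx_scalar.
exact: has_jac_mulr.
Qed.

Lemma has_jacB f g a A B : has_jac f a A -> has_jac g a B ->
  has_jac (fun z => f z - g z) a (A - B).
Proof.
move=> F G e e0; have e20 : 0 < e / 2 by rewrite divr_gt0.
have [d1 d10 K1] := F _ e20; have [d2 d20 K2] := G _ e20.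
exists (Num.min d1 d2); first by rewrite lt_min d10.
move=> z; rewrite lt_min => /andP[/K1 k1 /K2 k2].
have -> : f z - g z - (f a - g a) - (z - a) *m (A - B) =
  (f z - f a - (z - a) *m A) - (g z - g a - (z - a) *m B).
  by rewrite mulmxBr (subrACA (f z)) (subrACA (f z - f a)).
by rewrite (le_trans (enormB _ _)) // [in leRHS](splitr e) mulrDl lerD.
Qed.

Lemma has_jac_id a : has_jac id a 1%:M.
Proof. by move=> e e0; exists 1 => // z _; rewrite mulmx1 subrr enorm0 mulr_ge0 ?enorm_ge0 // ltW. Qed.

Lemma has_jac_cst a b : has_jac (fun=> b) a 0.
Proof. by move=> e e0; exists 1 => // z _; rewrite mulmx0 !subrr enorm0 mulr_ge0 ?enorm_ge0 // ltW. Qed.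

End Differential.
(** * Cauchy's estimate, the mean value inequality and Gronwall's inequality *)

Section Estimates.
Variables (R : realType) (k : nat).
Local Notation C := (Cx R).
Local Notation V := 'rV[C]_k.
Implicit Types (z w u v a x : V) (A B : 'M[C]_k) (f g : V -> V).
Local Open Scope complex_scope.

Lemma cderiv_derivable (f : C -> C) (z c : C) : cderiv f z c ->
  derivable f z 1 /\ 'D_1 f z = c.
Proof.
move=> H.
suff cv : h^-1 *: (f (h *: 1 + z) - f z) @[h --> 0^'] --> c.
  by split; [apply/cvg_ex; exists c | apply/cvg_lim].
apply/cvgrPdist_le => e /Cx_gt0[-> e0]; have [dl dl0 K] := H _ e0.
rewrite near_withinE; apply/near_cnorm; exists dl => // h; rewrite subr0 => hd h0.
have := K (h + z); rewrite addrK => /(_ hd) k1.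
rewrite cnormE lecR -cnormN opprB /GRing.scale /= mulr1.
have -> : h^-1 * (f (h + z) - f z) - c = h^-1 * (f (h + z) - f z - c * h).
  by rewrite [RHS]mulrBr [c * h]mulrC mulKf.
by rewrite cnormM cnormV mulrC ler_pdivrMr // cnorm_gt0.
Qed.

Lemma cderiv_line f x v w A (t : C) : has_jac f (x + t *: v) A ->
  cderiv (fun s => dotc (f (x + s *: v)) w) t (dotc (v *m A) w).
Proof.
move=> H e e0; pose N := (enorm v + 1) * (enorm w + 1).
have v1 : 0 < enorm v + 1 by rewrite ltr_wpDl ?enorm_ge0.
have w1 : 0 < enorm w + 1 by rewrite ltr_wpDl ?enorm_ge0.
have N0 : 0 < N by rewrite mulr_gt0.
have [dl dl0 K] := H (e / N) (divr_gt0 e0 N0).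
exists (dl / (enorm v + 1)); first by rewrite divr_gt0.
move=> s hs.
have E : x + s *: v - (x + t *: v) = (s - t) *: v.
  by rewrite opprD addrACA subrr add0r -scalerBl.
have := K (x + s *: v); rewrite E enormZ => h.
have hb : cnorm (s - t) * enorm v <= cnorm (s - t) * (enorm v + 1).
  by rewrite ler_wpM2l ?cnorm_ge0 // lerDl.
have {}h := h (le_lt_trans hb _).
rewrite -ltr_pdivlMr // in h; have {}h := h hs.
have -> : dotc (f (x + s *: v)) w - dotc (f (x + t *: v)) w - dotc (v *m A) w * (s - t)
  = dotc (f (x + s *: v) - f (x + t *: v) - (s - t) *: v *m A) w.
  by rewrite !dotcBl -scalemxAl dotcZl [_ * (s - t)]mulrC.
rewrite (le_trans (cauchy_schwarz _ _)) //.
rewrite (le_trans (ler_wpM2r (enorm_ge0 _) h)) //.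
rewrite (@le_trans _ _ (e / N * (cnorm (s - t) * (enorm v + 1)) * (enorm w + 1))) //.
  by rewrite !ler_pM ?enorm_ge0 ?mulr_ge0 ?cnorm_ge0 ?enorm_ge0 ?invr_ge0 ?lerDl // ltW.
rewrite /N le_eqVlt; apply/orP; left; apply/eqP; field; rewrite !gt_eqF //.
Qed.

(** The one-variable estimate, applied to t |-> <f (a + t v), w> on the disc of
    radius r / |v|, with w = v J, whose derivative at 0 is |w|^2. *)
Lemma cauchy_jac f a (r M : R) : 0 < r ->
  (forall z, enorm (z - a) < r -> differentiable f z) ->
  (forall z, enorm (z - a) < r -> enorm (f z - f a) <= M) ->
  opnorm ('J f a) * r <= M.
Proof.
move=> r0 df fM.
have M0 : 0 <= M by apply: le_trans (fM a _); rewrite ?enorm_ge0 // subrr enorm0.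
rewrite -ler_pdivlMr //; apply: opnorm_le; first by rewrite divr_ge0 // ltW.
move=> v; set w := v *m _.
have [->|w0] := eqVneq w 0; first by rewrite enorm0 mulr_ge0 ?enorm_ge0 // divr_ge0 // ltW.
have [v0|v0] := eqVneq v 0; first by move: w0; rewrite /w v0 mul0mx eqxx.
rewrite -!enorm_gt0 in v0 w0.
pose phi t := dotc (f (a + t *: v)) w.
have near_line (t : C) : cnorm t < r / enorm v -> enorm (a + t *: v - a) < r.
  by rewrite addrAC subrr add0r enormZ ltr_pdivlMr.
have dphi (t : C) : cnorm t < r / enorm v -> derivable phi t 1.
  move=> /near_line/df/diff_has_jac/(cderiv_line w)/cderiv_derivable[] //.
have D0 : 'D_1 phi 0 = dotc w w.
  have H : has_jac f (a + (0 : C) *: v) ('J f a).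
    rewrite scale0r addr0; apply: diff_has_jac; apply: df.
    by rewrite subrr enorm0.
  by have [_ ->] := cderiv_derivable (cderiv_line w H).
have := @cauchy_estimate R phi (r / enorm v) (M * enorm w) (divr_gt0 r0 v0) dphi.
rewrite D0 dotcc cnorm_real ger0_norm ?sqr_ge0 // => H.
have : enorm w ^+ 2 * (r / enorm v) <= M * enorm w.
  apply: H => t ht; rewrite /phi -dotcBl (le_trans (cauchy_schwarz _ _)) //.
  by rewrite ler_wpM2r ?enorm_ge0 // scale0r addr0 fM // near_line.
rewrite expr2 mulrAC ler_pM2r // mulrA ler_pdivrMr // -ler_pdivlMr //.
by rewrite mulrAC.
Qed.

Lemma is_derive_eps (g : R -> R) (t d : R) : (forall e : R, 0 < e -> exists2 dl : R, 0 < dl &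
    forall u : R, `|u - t| < dl -> `|g u - g t - d * (u - t)| <= e * `|u - t|) ->
  is_derive t 1 g d.
Proof.
move=> H.
suff cv : h^-1 *: (g (h *: 1 + t) - g t) @[h --> 0^'] --> d.
  by split; [apply/cvg_ex; exists d | apply/cvg_lim].
apply/cvgrPdist_le => e e0; have [dl dl0 K] := H _ e0.
rewrite near_withinE; exists dl => // h; rewrite /ball_ /= sub0r normrN => hd h0.
have := K (h + t); rewrite addrK => /(_ hd) k1.
rewrite distrC /GRing.scale /= mulr1.
have -> : h^-1 * (g (h + t) - g t) - d = h^-1 * (g (h + t) - g t - d * h).
  by rewrite [RHS]mulrBr [d * h]mulrC mulKf.
by rewrite normrM normfV mulrC ler_pdivrMr // normr_gt0.
Qed.

Lemma is_derive_line f x v w A (t : R) : has_jac f (x + t%:C *: v) A ->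
  is_derive t 1 (fun s : R => complex.Re (dotc (f (x + s%:C *: v)) w))
    (complex.Re (dotc (v *m A) w)).
Proof.
move=> /(cderiv_line w) H; apply: is_derive_eps => e /H[dl dl0 K].
exists dl => // u; have := K u%:C; rewrite -rmorphB /= cnorm_real => /[apply] h.
have -> : complex.Re (dotc (v *m A) w) * (u - t) =
   complex.Re (dotc (v *m A) w * (u - t)%:C) by rewrite ReM /= mulr0 subr0.
by rewrite -!ReN -!ReD (le_trans (ler_Re_cnorm _)).
Qed.

Lemma mean_value f x v (c : R) :
  (forall t, 0 <= t <= 1 -> differentiable f (x + t%:C *: v) /\
     enorm (v *m 'J f (x + t%:C *: v)) <= c) ->
  enorm (f (x + v) - f x) <= c.
Proof.
move=> H; set w := f (x + v) - f x.
have c0 : 0 <= c.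
  by have [|_] := H 0; rewrite ?lexx ?ler01 //; apply: le_trans (enorm_ge0 _).
have [->|w0] := eqVneq w 0; first by rewrite enorm0.
rewrite -enorm_gt0 in w0.
pose g (s : R) := complex.Re (dotc (f (x + s%:C *: v)) w).
have dg (t : R) : 0 <= t <= 1 ->
    is_derive t 1 g (complex.Re (dotc (v *m 'J f (x + t%:C *: v)) w)).
  by move=> /H[/diff_has_jac/(is_derive_line w)].
have [t /= ti E] : exists2 t, t \in `[0, 1]%R & g 1 - g 0 =
    complex.Re (dotc (v *m 'J f (x + t%:C *: v)) w) * (1 - 0).
  apply: (@MVT_segment R g (fun t => complex.Re (dotc (v *m 'J f (x + t%:C *: v)) w))) => //.
    by move=> t; rewrite in_itv /= => /andP[h0 h1]; apply: dg; rewrite !ltW.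
  apply: derivable_within_continuous => t; rewrite in_itv /= => /dg[] //.
have E2 : g 1 - g 0 = enorm w ^+ 2.
  by rewrite /g -ReN -ReD -dotcBl scale1r scale0r addr0 -/w dotcc.
rewrite -(ler_pM2r w0) -expr2 -E2 E subr0 mulr1.
rewrite (le_trans (ler_norm _)) // (le_trans (ler_Re_cnorm _)) //.
rewrite (le_trans (cauchy_schwarz _ _)) // ler_wpM2r ?enorm_ge0 //.
by move: ti; rewrite in_itv /= => /H[].
Qed.

Lemma mean_value_opnorm f a (r c : R) x z :
  (forall z, enorm (z - a) < r -> differentiable f z /\ opnorm ('J f z) <= c) ->
  enorm (x - a) < r -> enorm (z - a) < r ->
  enorm (f z - f x) <= c * enorm (z - x).
Proof.
move=> H xr zr.
have {1}-> : z = x + (z - x) by rewrite addrC subrK.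
apply: mean_value => t /andP[t0 t1].
have zt : enorm (x + t%:C *: (z - x) - a) < r.
  have -> : x + t%:C *: (z - x) - a = (1 - t)%:C *: (x - a) + t%:C *: (z - a).
    apply/rowP => i; rewrite !mxE rmorphB rmorph1; ring.
  rewrite (le_lt_trans (enormD _ _)) // !enormZ !cnorm_real.
  rewrite !ger0_norm ?subr_ge0 //.
  have [->|tn0] := eqVneq t 0; first by rewrite subr0 mul1r mul0r addr0.
  have tp : 0 < t by rewrite lt_def tn0.
  have -> : r = (1 - t) * r + t * r by rewrite -mulrDl subrK mul1r.
  by rewrite ler_ltD // ?ltr_pM2l // ler_wpM2l ?subr_ge0 // ltW.
have [dz Jz] := H _ zt; split=> //.
rewrite (le_trans (opnormP _ _)) // ler_wpM2r ?enorm_ge0 //.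
Qed.

(** The inverse of the density of the complete metric |dw| / sqrt (1 + |w|^2). *)
Definition bracket w : R := Num.sqrt (1 + enorm w ^+ 2).

Lemma bracket_sqr w : bracket w ^+ 2 = 1 + enorm w ^+ 2.
Proof. by rewrite sqr_sqrtr // addr_ge0 // sqr_ge0. Qed.

Lemma bracket_ge1 w : 1 <= bracket w.
Proof. by rewrite -[1]sqrtr1 ler_wsqrtr // lerDl sqr_ge0. Qed.

Lemma bracket_gt0 w : 0 < bracket w.
Proof. exact: lt_le_trans (bracket_ge1 w). Qed.

Lemma enorm_le_bracket w : enorm w <= bracket w.
Proof.
rewrite -ler_sqr ?nnegrE ?enorm_ge0 ?(ltW (bracket_gt0 _)) //.
by rewrite bracket_sqr lerDr.
Qed.

Lemma bracket_le w : bracket w <= 1 + enorm w.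
Proof.
rewrite -ler_sqr ?nnegrE ?addr_ge0 ?enorm_ge0 ?(ltW (bracket_gt0 _)) //.
by rewrite bracket_sqr sqrrD expr1n mul1r lerD2r lerDl mulrn_wge0 ?enorm_ge0.
Qed.

Lemma Re_dotc u w : complex.Re (dotc u w) = \sum_(j < k)
  (complex.Re (u ord0 j) * complex.Re (w ord0 j)
   + complex.Im (u ord0 j) * complex.Im (w ord0 j)).
Proof.
rewrite /dotc (big_morph _ (@ReD R) (erefl : complex.Re (0 : C) = 0)).
by apply: eq_bigr => j _; rewrite ReM; case: (w ord0 j) => a b /=; rewrite mulrN opprK.
Qed.

Lemma enormD_sqr u w :
  enorm (u + w) ^+ 2 = enorm u ^+ 2 + 2 * complex.Re (dotc u w) + enorm w ^+ 2.
Proof.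
rewrite !enorm_sqr Re_dotc mulr_sumr -!big_split /=; apply: eq_bigr => j _.
by rewrite mxE !cnorm_sqr ReD ImD; ring.
Qed.

Lemma is_derive_enorm2 f x v A (t : R) : has_jac f (x + t%:C *: v) A ->
  is_derive t 1 (fun s : R => enorm (f (x + s%:C *: v)) ^+ 2)
    (2 * complex.Re (dotc (v *m A) (f (x + t%:C *: v)))).
Proof.
move=> H; set y0 := f (x + t%:C *: v).
(* |f|^2 - |y0|^2 = 2 Re <f - y0, y0> + |f - y0|^2, and the last term is quadratic *)
apply: is_derive_eps => e e0.
have e20 : 0 < e / 2 by rewrite divr_gt0.
pose n := enorm v + 1; have n0 : 0 < n by rewrite ltr_wpDl ?enorm_ge0.
pose m := enorm y0 + 1; have m0 : 0 < m by rewrite ltr_wpDl ?enorm_ge0.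
pose K := (opnorm A + 1); have K0 : 0 < K by rewrite ltr_wpDl ?opnorm_ge0.
have [d1 d10 H1] := H (e / 4 / (n * m)) ltac:(by rewrite !divr_gt0 // mulr_gt0).
have [d2 d20 H2] := has_jac_lip H.
pose d3 := e / 2 / (K * n) ^+ 2.
have d30 : 0 < d3 by rewrite divr_gt0 // exprn_gt0 // mulr_gt0.
exists (Num.min (Num.min d1 d2 / n) d3).
  by rewrite lt_min d30 andbT divr_gt0 // lt_min d10.
move=> u; rewrite lt_min => /andP[ud u3].
move: ud; rewrite ltr_pdivlMr // lt_min => /andP[u1 u2].
set y := f (x + u%:C *: v).
have E : x + u%:C *: v - (x + t%:C *: v) = (u - t)%:C *: v.
  by rewrite opprD addrACA subrr add0r -scalerBl rmorphB.
have hb : enorm ((u - t)%:C *: v) <= `|u - t| * n.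
  by rewrite enormZ cnorm_real ler_wpM2l // lerDl.
have := H1 (x + u%:C *: v); rewrite E -/y -/y0 => /(_ (le_lt_trans hb u1)) h1.
have := H2 (x + u%:C *: v); rewrite E -/y -/y0 -/K => /(_ (le_lt_trans hb u2)) h2.
have -> : enorm y ^+ 2 - enorm y0 ^+ 2 - 2 * complex.Re (dotc (v *m A) y0) * (u - t)
  = 2 * complex.Re (dotc (y - y0 - (u - t)%:C *: v *m A) y0) + enorm (y - y0) ^+ 2.
  rewrite -[y in enorm y ^+ 2 - _](subrK y0) (enormD_sqr (y - y0)) !dotcBl -scalemxAl dotcZl.
  by rewrite !(ReD, ReN, ReM) /=; ring.
have -> : e * `|u - t| = e / 2 * `|u - t| + e / 2 * `|u - t|.
  by rewrite -mulrDl -splitr.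
rewrite (le_trans (ler_normD _ _)) // lerD //.
  rewrite normrM ger0_norm // (le_trans (ler_wpM2l _ (ler_Re_cnorm _))) //.
  rewrite (le_trans (ler_wpM2l _ (cauchy_schwarz _ _))) //.
  rewrite (@le_trans _ _ (2 * (e / 4 / (n * m) * (`|u - t| * n) * m))) //.
    rewrite ler_wpM2l // ler_pM ?enorm_ge0 //; last by rewrite lerDl.
    by rewrite (le_trans h1) // ler_wpM2l // !divr_ge0 ?mulr_ge0 // ltW.
  rewrite le_eqVlt; apply/orP; left; apply/eqP; field; rewrite !gt_eqF //.
rewrite ger0_norm ?sqr_ge0 // (@le_trans _ _ ((K * (`|u - t| * n)) ^+ 2)) //.
  rewrite ler_sqr ?nnegrE ?enorm_ge0 //; last by rewrite !mulr_ge0 // ltW.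
  by rewrite (le_trans h2) // ler_wpM2l // ltW.
have -> : (K * (`|u - t| * n)) ^+ 2 = (`|u - t| * (K * n) ^+ 2) * `|u - t| by ring.
rewrite ler_wpM2r // -ler_pdivlMr ?exprn_gt0 ?mulr_gt0 // ltW //.
Qed.

(** The square h of the bracket satisfies |h'| <= 2 L h along the segment, by
    Cauchy-Schwarz. *)
Lemma gronwall_upper f x v (L : R) :
  (forall t, 0 <= t <= 1 -> differentiable f (x + t%:C *: v) /\
     enorm (v *m 'J f (x + t%:C *: v)) <= L * bracket (f (x + t%:C *: v))) ->
  bracket (f (x + v)) <= bracket (f x) * expR L.
Proof.
move=> H.
pose y (t : R) := f (x + t%:C *: v).
pose h (t : R) := 1 + enorm (y t) ^+ 2.
pose h' (t : R) := 2 * complex.Re (dotc (v *m 'J f (x + t%:C *: v)) (y t)).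
have dh (t : R) : 0 <= t <= 1 -> is_derive t 1 h (h' t).
  move=> /H[/diff_has_jac/is_derive_enorm2 D _].
  have c1 : is_derive t (1 : R) (cst (1 : R)) 0 by exact: is_derive_cst.
  by apply: (is_derive_eq (is_deriveD c1 D)); rewrite add0r.
have hle (t : R) : 0 <= t <= 1 -> h' t <= 2 * L * h t.
  move=> /H[_ hL]; rewrite /h' -mulrA ler_pM2l //.
  rewrite (le_trans (ler_norm _)) // (le_trans (ler_Re_cnorm _)) //.
  rewrite (le_trans (cauchy_schwarz _ _)) //.
  rewrite /h -bracket_sqr expr2 mulrA.
  by rewrite ler_pM ?enorm_ge0 // enorm_le_bracket.
pose g (t : R) := h t * expR (- (2 * L * t)).
have dg (t : R) : 0 <= t <= 1 -> is_derive t 1 g ((h' t - 2 * L * h t) * expR (- (2 * L * t))).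
  move=> /dh D.
  have E : is_derive t 1 (fun t : R => expR (- (2 * L * t))) (- (2 * L) * expR (- (2 * L * t))).
    apply: is_derive_eq; rewrite /GRing.scale /=; ring.
  by apply: (is_derive_eq (is_deriveM D E)); rewrite /GRing.scale /=; ring.
have g1 : g 1 = bracket (f (x + v)) ^+ 2 / expR (2 * L).
  by rewrite /g /h /y mulr1 expRN scale1r bracket_sqr.
have g0 : g 0 = bracket (f x) ^+ 2.
  by rewrite /g /h /y mulr0 oppr0 expR0 mulr1 scale0r addr0 bracket_sqr.
have : g 1 <= g 0.
  apply: (@ler0_derive1_nincr R g 0 1) => //.
  - by move=> t; rewrite in_itv /= => /andP[t0 t1]; have [] := dg t _; rewrite ?ltW.
  - move=> t; rewrite in_itv /= => /andP[t0 t1].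
    have ti : 0 <= t <= 1 by rewrite !ltW.
    have [_] := dg t ti; rewrite derive1E => ->.
    by rewrite mulr_le0_ge0 ?expR_ge0 // subr_le0 hle.
  - by apply: derivable_within_continuous => t; rewrite in_itv /= => /dg[].
rewrite g1 g0.
rewrite ler_pdivrMr ?expR_gt0 // => K.
rewrite -ler_sqr ?nnegrE ?mulr_ge0 ?expR_ge0 ?(ltW (bracket_gt0 _)) //.
by rewrite exprMn -expRM_natl.
Qed.

(** The segment run backwards. *)
Lemma gronwall_lower f x v (L : R) :
  (forall t, 0 <= t <= 1 -> differentiable f (x + t%:C *: v) /\
     enorm (v *m 'J f (x + t%:C *: v)) <= L * bracket (f (x + t%:C *: v))) ->
  bracket (f x) <= bracket (f (x + v)) * expR L.
Proof.
move=> H; rewrite -{1}[x](addrK v); apply: gronwall_upper => t /andP[t0 t1].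
have -> : x + v + t%:C *: - v = x + (1 - t)%:C *: v.
  by rewrite rmorphB scalerBl scale1r scalerN addrA.
by rewrite mulNmx enormN; apply: H; rewrite subr_ge0 t1 lerBlDr lerDl.
Qed.

End Estimates.
(** * Normal families along an ultrafilter *)

Section Ultralimits.
Variables (R : realType) (k : nat) (U : set_system nat).
Context {UU : UltraFilter U}.
Local Notation C := (Cx R).
Local Notation V := 'rV[C]_k.
Implicit Types (z w u v a l : V) (A B : 'M[C]_k) (f g : V -> V).
Local Open Scope complex_scope.

Lemma ultra_or (P : nat -> Prop) : (\forall n \near U, P n) \/ (\forall n \near U, ~ P n).
Proof. exact: (@in_ultra_setVsetC _ U [set n | P n] UU). Qed.

Lemma ultra_real (x : nat -> R) (M : R) : (\forall n \near U, `|x n| <= M) ->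
  exists l : R, forall e : R, 0 < e -> \forall n \near U, `|x n - l| < e.
Proof.
move=> xM; pose S := [set a | \forall n \near U, a <= x n].
have S0 : S (- M) by apply: filterS xM => n; rewrite ler_norml => /andP[].
have Sub : ubound S M.
  move=> a Sa; have [n [/= an]] := filter_ex (filterI Sa xM).
  by rewrite ler_norml => /andP[_ xn]; exact: le_trans an xn.
have hS : has_sup S by split; [exists (- M) | exists M].
exists (sup S) => e e0.
have [a Sa ale] := sup_adherent e0 hS.
have [hi|hi] := ultra_or (fun n => sup S + e / 2 <= x n).
  have := sup_upper_bound hS hi; rewrite gerDl leNgt divr_gt0 //.
apply: filterS2 Sa hi => n h1 /negP; rewrite -ltNge => h2.
rewrite ltr_norml; apply/andP; split; first by rewrite ltrBrDl (lt_le_trans ale).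
rewrite ltrBlDl (lt_trans h2) // ltrD2l ltr_pdivrMr // ltr_pMr // ltr1n //.
Qed.

(** Limits along an ultrafilter exist for all bounded sequences and commute with
    the linear operations, which replaces repeated extraction of subsequences. *)
Definition ulim_to (x : nat -> V) l :=
  forall e : R, 0 < e -> \forall n \near U, enorm (x n - l) < e.

Lemma ulim_exists (x : nat -> V) (M : R) : (\forall n \near U, enorm (x n) <= M) ->
  exists l, ulim_to x l.
Proof.
move=> xM.
have hr j : exists l : R, forall e : R, 0 < e -> \forall n \near U, `|complex.Re (x n ord0 j) - l| < e.
  apply: (@ultra_real _ M); apply: filterS xM => n h.
  by rewrite (le_trans (ler_Re_cnorm _)) // (le_trans (cnorm_le_enorm _ _)).
have hi j : exists l : R, forall e : R, 0 < e -> \forall n \near U, `|complex.Im (x n ord0 j) - l| < e.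
  apply: (@ultra_real _ M); apply: filterS xM => n h.
  by rewrite (le_trans (ler_Im_cnorm _)) // (le_trans (cnorm_le_enorm _ _)).
have [lr Hr] := choice hr; have [li Hi] := choice hi.
exists (\row_j (lr j +i* li j)) => e e0.
have k0 : 0 < k%:R + 1 :> R by rewrite ltr_wpDl.
pose d := e / 2 / (k%:R + 1); have d0 : 0 < d by rewrite !divr_gt0.
have : \forall n \near U, forall j, `|complex.Re (x n ord0 j) - lr j| < d /\
     `|complex.Im (x n ord0 j) - li j| < d.
  apply: filter_forall => j.
  exact: filterI (Hr j d d0) (Hi j d d0).
apply: filterS => n H; rewrite (le_lt_trans (enorm_le_sum _)) //.
rewrite (@le_lt_trans _ _ (\sum_(j < k) (d + d))) //.
  apply: ler_sum => j _; rewrite !mxE (le_trans (cnorm_le_ReIm _)) //.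
  have [h1 h2] := H j; rewrite ReD ImD ReN ImN /= lerD // ltW //.
rewrite sumr_const card_ord -mulr_natl.
have -> : e = (k%:R + 1) * (d + d) by rewrite /d; field; rewrite gt_eqF.
by rewrite ltr_pM2r ?addr_gt0 // ltrDl.
Qed.

Lemma ulim_le (x : nat -> V) l u (M : R) : ulim_to x l ->
  (\forall n \near U, enorm (x n - u) <= M) -> enorm (l - u) <= M.
Proof.
move=> xl xM; apply/ler_addgt0Pr => e e0.
have [n [/= h1 h2]] := filter_ex (filterI (xl e e0) xM).
rewrite -[l](subrK (x n)) -addrA (le_trans (enormD _ _)) // [M + e]addrC lerD //.
by rewrite enorm_sub ltW.
Qed.

Lemma ulim_uniq (x : nat -> V) l1 l2 : ulim_to x l1 -> ulim_to x l2 -> l1 = l2.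
Proof.
move=> h1 h2; apply/eqP; rewrite -subr_eq0 -enorm_eq0 eq_le enorm_ge0 andbT.
apply/ler_addgt0Pr => e e0; rewrite add0r; apply: (ulim_le h1).
by apply: filterS (h2 e e0) => n /ltW.
Qed.

Lemma ulim_cst l : ulim_to (fun=> l) l.
Proof. by move=> e e0; apply: nearW => n; rewrite subrr enorm0. Qed.

Lemma ulimD (x y : nat -> V) l m : ulim_to x l -> ulim_to y m ->
  ulim_to (fun n => x n + y n) (l + m).
Proof.
move=> xl ym e e0; have e20 : 0 < e / 2 by rewrite divr_gt0.
apply: filterS2 (xl _ e20) (ym _ e20) => n h1 h2.
by rewrite opprD addrACA (le_lt_trans (enormD _ _)) // (splitr e) ltrD.
Qed.

Lemma ulim_mulmx (x : nat -> V) l A : ulim_to x l ->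
  ulim_to (fun n => x n *m A) (l *m A).
Proof.
move=> xl e e0; have c0 : 0 < opnorm A + 1 by rewrite ltr_wpDl ?opnorm_ge0.
apply: filterS (xl _ (divr_gt0 e0 c0)) => n h.
rewrite -mulmxBl (le_lt_trans (opnormP _ _)) // mulrC.
rewrite (@le_lt_trans _ _ (enorm (x n - l) * (opnorm A + 1))) //.
  by rewrite ler_wpM2l ?enorm_ge0 // lerDl.
by rewrite -ltr_pdivlMr.
Qed.

Lemma ulimZ (x : nat -> V) l (c : C) : ulim_to x l ->
  ulim_to (fun n => c *: x n) (c *: l).
Proof.
move=> /(@ulim_mulmx _ _ c%:M); rewrite mul_mx_scalar.
by under [X in ulim_to X]eq_fun => n do rewrite mul_mx_scalar.
Qed.

Lemma ulim_sum (I : Type) (s : seq I) (x : I -> nat -> V) (l : I -> V) :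
  (forall i, ulim_to (x i) (l i)) ->
  ulim_to (fun n => \sum_(i <- s) x i n) (\sum_(i <- s) l i).
Proof.
move=> H; elim: s => [|i s IH].
  rewrite big_nil; under [X in ulim_to X]eq_fun => n do rewrite big_nil.
  exact: ulim_cst.
rewrite big_cons; under [X in ulim_to X]eq_fun => n do rewrite big_cons.
exact: ulimD.
Qed.

Lemma ulim_mx (D : nat -> 'M[C]_k) (M : R) : (\forall n \near U, opnorm (D n) <= M) ->
  exists A, forall v, ulim_to (fun n => v *m D n) (v *m A).
Proof.
move=> DM.
have h i : exists l, ulim_to (fun n => delta_mx ord0 i *m D n) l.
  apply: (@ulim_exists _ M); apply: filterS DM => n h.
  by rewrite (le_trans (opnormP _ _)) // enorm_delta mulr1.
have [l Hl] := choice h.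
exists (\matrix_(i < k) l i) => v.
have E B : v *m B = \sum_i v ord0 i *: (delta_mx ord0 i *m B).
  rewrite {1}[v]row_sum_delta mulmx_suml; apply: eq_bigr => i _.
  by rewrite -scalemxAl.
rewrite E; under [X in ulim_to X]eq_fun => n do rewrite E.
apply: ulim_sum => i; apply: ulimZ.
by rewrite -rowE rowK.
Qed.

Section Montel.
Variables (F : nat -> V -> V) (g : V -> V) (a : V) (r M : R).
Hypothesis Fhol : \forall n \near U, forall z, enorm (z - a) < r ->
  differentiable (F n) z /\ enorm (F n z) <= M.
Hypothesis Fg : forall z, enorm (z - a) < r -> ulim_to (fun n => F n z) (g z).

Lemma in_ball_sub z w (s : R) : enorm (w - z) < s - enorm (z - a) -> enorm (w - a) < s.
Proof.
rewrite ltrBrDr; apply: le_lt_trans.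
by rewrite -[w - a](subrKA z) enormD.
Qed.

Lemma montel_opnorm (s : R) : s < r -> \forall n \near U, forall z, enorm (z - a) < s ->
  differentiable (F n) z /\ opnorm ('J (F n) z) <= 2 * M / (r - s).
Proof.
move=> sr; apply: filterS Fhol => n H z zs.
have zr : enorm (z - a) < r by exact: lt_trans sr.
split; first by have [] := H z zr.
have rs : 0 < r - s by rewrite subr_gt0.
rewrite ler_pdivlMr //; apply: cauchy_jac => // w hw.
  apply: (H w _).1; apply: (@in_ball_sub z).
  by rewrite (lt_le_trans hw) // lerD2l lerN2 ltW.
have wr : enorm (w - a) < r.
  apply: (@in_ball_sub z).
  by rewrite (lt_le_trans hw) // lerD2l lerN2 ltW.
rewrite (le_trans (enormB _ _)) // mulr_natl mulr2n lerD //.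
  by have [] := H w wr.
by have [] := H z zr.
Qed.

Lemma montel_lipschitz (s : R) : s < r -> exists2 L : R, 0 < L &
  (\forall n \near U, forall z w, enorm (z - a) < s -> enorm (w - a) < s ->
    enorm (F n z - F n w) <= L * enorm (z - w)) /\
  (forall z w, enorm (z - a) < s -> enorm (w - a) < s ->
    enorm (g z - g w) <= L * enorm (z - w)).
Proof.
move=> sr; pose L := `|2 * M / (r - s)| + 1.
have L0 : 0 < L by rewrite ltr_wpDl.
have Hn : \forall n \near U, forall z w, enorm (z - a) < s -> enorm (w - a) < s ->
    enorm (F n z - F n w) <= L * enorm (z - w).
  apply: filterS (montel_opnorm sr) => n H z w zs ws.
  rewrite (le_trans (mean_value_opnorm H ws zs)) // ler_wpM2r ?enorm_ge0 //.
  by rewrite (le_trans (ler_norm _)) // lerDl.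
exists L => //; split=> // z w zs ws.
have hz := Fg (lt_trans zs sr); have hw := Fg (lt_trans ws sr).
have hd := ulimD hz (@ulimZ _ _ (-1) hw).
have := @ulim_le _ _ 0 (L * enorm (z - w)) hd.
rewrite subr0 scaleN1r; apply.
by apply: filterS Hn => n H; rewrite subr0 scaleN1r; exact: H.
Qed.

(** Members and limit are equi-Lipschitz, so that pointwise convergence fails at
    the limit of points where the convergence is not uniform. *)
Lemma montel_unif (s e : R) : s < r -> 0 < e ->
  \forall n \near U, forall z, enorm (z - a) < s -> enorm (F n z - g z) < e.
Proof.
move=> sr e0.
have [//|bad] := ultra_or (fun n => forall z, enorm (z - a) < s -> enorm (F n z - g z) < e).
exfalso.
(* the points z n where F n is far from g tend to a point z0 of a larger ball *)
have /choice[z zP] n : exists z, ~ (forall z, enorm (z - a) < s -> enorm (F n z - g z) < e) ->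
    enorm (z - a) < s /\ e <= enorm (F n z - g z).
  have [h|] := pselect (exists z, enorm (z - a) < s /\ e <= enorm (F n z - g z)).
    by case: h => z hz; exists z.
  move=> h; exists 0 => nh; exfalso; apply: nh => z zs; rewrite ltNge; apply/negP => he.
  by apply: h; exists z.
have {}bad : \forall n \near U, enorm (z n - a) < s /\ e <= enorm (F n (z n) - g (z n)).
  by apply: filterS bad => n /zP.
have [s1 s2] : s < (s + r) / 2 /\ (s + r) / 2 < r by have [] := midf_lt sr.
have [L L0 [LF Lg]] := montel_lipschitz s2.
have [z0 zz0] : exists z0, ulim_to z z0.
  apply: (@ulim_exists _ (s + enorm a)); apply: filterS bad => n [h _].
  rewrite -[z n](subrK a) (le_trans (enormD _ _)) // lerD2r ltW //.
have z0s : enorm (z0 - a) < (s + r) / 2.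
  rewrite (le_lt_trans _ s1) //; apply: (ulim_le zz0).
  by apply: filterS bad => n [/ltW].
have e30 : 0 < e / 3 by rewrite divr_gt0.
have d0 : 0 < e / 3 / L by rewrite divr_gt0.
have : \forall n \near U, False.
  apply: filterS3 (filterI bad LF) (zz0 _ d0) (Fg (lt_trans z0s s2) e30) => n [[h1 h2] h3] h4 h5.
  have zns := lt_trans h1 s1.
  have l1 : enorm (F n (z n) - F n z0) < e / 3.
    by rewrite (le_lt_trans (h3 _ _ zns z0s)) // mulrC -ltr_pdivlMr.
  have l2 : enorm (g z0 - g (z n)) < e / 3.
    rewrite (le_lt_trans (Lg _ _ z0s zns)) // mulrC -ltr_pdivlMr //.
    by rewrite enorm_sub.
  move: h2; apply/negP; rewrite -ltNge.
  rewrite -(subrKA (F n z0)) -(subrKA (g z0) (F n z0)) (le_lt_trans (enormD _ _)) //.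
  have -> : e = e / 3 + (e / 3 + e / 3) by field.
  by rewrite ltrD // (le_lt_trans (enormD _ _)) // ltrD.
by move=> /filter_ex[].
Qed.

(** The differences F n - F m are uniformly small, hence so are their
    differentials by Cauchy's estimate. By the mean value inequality the first
    order expansion of a single F n at z then holds for g, with the limit of the
    differentials, up to a small multiple of |w - z|. *)
Lemma montel_jac z : enorm (z - a) < r ->
  exists A, has_jac g z A /\ forall v, ulim_to (fun n => v *m 'J (F n) z) (v *m A).
Proof.
move=> zr.
have [h1 h2] : enorm (z - a) < (enorm (z - a) + r) / 2 /\ (enorm (z - a) + r) / 2 < r.
  by have [] := midf_lt zr.
set s := (_ + r) / 2 in h1 h2.
have bJ : \forall n \near U, opnorm ('J (F n) z) <= 2 * M / (r - s).
  by apply: filterS (montel_opnorm h2) => n /(_ z h1)[].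
have [A HA] := ulim_mx bJ.
exists A; split=> // e e0.
pose t := s - enorm (z - a); have t0 : 0 < t by rewrite subr_gt0.
(* F n - F m varies by at most 4 eta, so Cauchy's estimate on balls of radius
   t / 2 bounds the difference of the differentials by e / 4 *)
pose eta := e * t / 32; have eta0 : 0 < eta by rewrite divr_gt0 // mulr_gt0.
pose good n := (forall w, enorm (w - a) < s -> differentiable (F n) w) /\
  (forall w, enorm (w - a) < s -> enorm (F n w - g w) < eta).
have Ugood : \forall n \near U, good n.
  apply: filterS2 (montel_unif h2 eta0) (montel_opnorm h2) => n H1 H2.
  by split=> // w ws; have [] := H2 w ws.
have t20 : 0 < t / 2 by rewrite divr_gt0.
have diffJ n m w : good n -> good m -> enorm (w - a) < s ->
    has_jac (fun x => F n x - F m x) w ('J (F n) w - 'J (F m) w).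
  move=> [dn _] [dm _] ws; apply: has_jacB; apply: diff_has_jac.
    exact: dn.
  exact: dm.
have key n m : good n -> good m -> forall w, enorm (w - z) < t / 2 ->
    opnorm ('J (F n) w - 'J (F m) w) <= e / 4.
  move=> gn gm w wz.
  have sub x : enorm (x - w) < t / 2 -> enorm (x - a) < s.
    move=> xw; apply: (@in_ball_sub z); rewrite -/t -(subrKA w).
    by rewrite (le_lt_trans (enormD _ _)) // [t]splitr ltrD.
  have ws : enorm (w - a) < s by apply: sub; rewrite subrr enorm0.
  have [_ <-] := has_jac_diff (diffJ n m w gn gm ws).
  rewrite (_ : e / 4 = 4 * eta / (t / 2)); last by rewrite /eta; field; rewrite gt_eqF.
  rewrite ler_pdivlMr //.
  apply: (@cauchy_jac _ _ (fun x => F n x - F m x) w); [exact: t20| |]; move=> x /sub xs.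
    by have [] := has_jac_diff (diffJ n m x gn gm xs).
  have Fnm y : enorm (y - a) < s -> enorm (F n y - F m y) <= 2 * eta.
    move=> ys; rewrite -(subrKA (g y)) (le_trans (enormD _ _)) //.
    rewrite mulr_natl mulr2n lerD //; last rewrite enorm_sub.
      by have [_ /(_ y ys)/ltW] := gn.
    by have [_ /(_ y ys)/ltW] := gm.
  rewrite (le_trans (enormB _ _)) // (_ : 4 * eta = 2 * eta + 2 * eta); last by ring.
  by rewrite lerD // Fnm.
have zt : enorm (z - z) < t / 2 by rewrite subrr enorm0.
have keyz n m v : good n -> good m ->
    enorm (v *m 'J (F m) z - v *m 'J (F n) z) <= e / 4 * enorm v.
  move=> gn gm; rewrite -mulmxBr (le_trans (opnormP _ _)) //.
  by rewrite ler_wpM2r ?enorm_ge0 // key.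
have keyw n m w : good n -> good m -> enorm (w - z) < t / 2 ->
    enorm ((F m w - F m z) - (F n w - F n z)) <= e / 4 * enorm (w - z).
  move=> gn gm wz; rewrite subrACA.
  apply: (@mean_value_opnorm _ _ (fun x => F m x - F n x) z (t / 2));
    [|exact: zt|exact: wz]; move=> x xz.
  have xs : enorm (x - a) < s.
    by apply: (@in_ball_sub z); rewrite -/t (lt_trans xz) // ltr_pdivrMr // ltr_pMr // ltr1n.
  by have [h ->] := has_jac_diff (diffJ m n x gm gn xs); split => //; exact: key.
have [n gn] := filter_ex Ugood.
have e20 : 0 < e / 2 by rewrite divr_gt0.
have dFn : differentiable (F n) z by apply: gn.1.
have [d1 d10 H1] := diff_has_jac dFn e20.
exists (Num.min d1 (t / 2)); first by rewrite lt_min d10.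
move=> w; rewrite lt_min => /andP[wd wt].
have ws : enorm (w - a) < s.
  by apply: (@in_ball_sub z); rewrite -/t (lt_trans wt) // ltr_pdivrMr // ltr_pMr // ltr1n.
have b1 : enorm ((w - z) *m A - (w - z) *m 'J (F n) z) <= e / 4 * enorm (w - z).
  apply: (ulim_le (HA (w - z))).
  by apply: filterS Ugood => m; exact: keyz.
have b2 : enorm ((g w - g z) - (F n w - F n z)) <= e / 4 * enorm (w - z).
  have hw := Fg (lt_trans ws h2); have hz := Fg zr.
  have := ulimD hw (@ulimZ _ _ (-1) hz); rewrite scaleN1r => hd.
  apply: (ulim_le hd); apply: filterS Ugood => m gm; rewrite scaleN1r.
  exact: keyw.
have b3 := H1 w wd.
have -> : g w - g z - (w - z) *m A = ((g w - g z) - (F n w - F n z)) +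
   ((F n w - F n z - (w - z) *m 'J (F n) z) - ((w - z) *m A - (w - z) *m 'J (F n) z)).
  by rewrite [in RHS](subrACA (F n w - F n z)) subrr subr0 subrKA.
have -> : e = e / 4 + (e / 2 + e / 4) by field.
rewrite mulrDl (le_trans (enormD _ _)) // lerD //.
by rewrite mulrDl (le_trans (enormB _ _)) // lerD.
Qed.

End Montel.

End Ultralimits.
(** * Rigidity of maps of bounded distortion *)

Section Rigidity.
Variables (R : realType) (k : nat).
Local Notation C := (Cx R).
Local Notation V := 'rV[C]_k.
Implicit Types (z w u v x a : V) (A B E : 'M[C]_k) (f g : V -> V).
Local Open Scope complex_scope.

Lemma ultra_oo : exists U : set_system nat, UltraFilter U /\ (\oo `<=` U).
Proof. by have [U [UU H]] := @ultraFilterLemma _ (\oo : set_system nat) _; exists U. Qed.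

(** Otherwise f would be unbounded along a sequence with a limit in the larger
    ball, at which f is continuous. *)
Lemma bounded_on_ball f a (s r : R) : s < r ->
  (forall z, enorm (z - a) < r -> differentiable f z) ->
  exists2 M : R, 0 <= M & forall z, enorm (z - a) < s -> enorm (f z) <= M.
Proof.
move=> sr df; apply: contrapT => bad.
have /choice[z zP] (n : nat) : exists z, enorm (z - a) < s /\ n%:R < enorm (f z).
  apply: contrapT => h; apply: bad; exists n%:R => // z zs.
  by rewrite leNgt; apply/negP => hz; apply: h; exists z.
have [U [UU Uoo]] := ultra_oo.
have [l zl] : exists l, ulim_to U z l.
  apply: (@ulim_exists _ _ U _ _ (s + enorm a)); apply: nearW => n.
  rewrite -[z n](subrK a) (le_trans (enormD _ _)) // lerD2r ltW //.
  by have [] := zP n.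
have lr : enorm (l - a) < r.
  rewrite (le_lt_trans _ sr) //; apply: (ulim_le zl).
  by apply: nearW => n; have [/ltW] := zP n.
have [dl dl0 H] := has_jac_cont (diff_has_jac (df l lr)) ltr01.
have big : \forall n \near U, enorm (f l) + 1 <= n%:R.
  apply: Uoo; exact: nbhs_infty_ger.
have [n [/= h1 h2]] := filter_ex (filterI (zl _ dl0) big).
have [_ h3] := zP n.
have := H _ h1; apply/negP; rewrite -leNgt.
rewrite (le_trans _ (enormB_ge _ _)) // lerBrDl.
by rewrite (le_trans h2) // ltW.
Qed.

(** The difference quotients (f (z + h v) - f (z)) / h are holomorphic in z,
    uniformly bounded near a, and tend to v J f (z) as h -> 0. *)
Lemma partial_diff f a v (r : R) : 0 < r ->
  (forall z, enorm (z - a) < r -> differentiable f z) ->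
  differentiable (fun z => v *m 'J f z) a.
Proof.
move=> r0 df.
have r34 : r * (3 / 4) < r by rewrite gtr_pMr //; lra.
have [M M0 fM] := bounded_on_ball r34 df.
pose L := 2 * M / (r / 4).
have opJ z : enorm (z - a) < r / 2 -> differentiable f z /\ opnorm ('J f z) <= L.
  move=> zr; split; first by apply: df; rewrite (lt_trans zr) // ltr_pdivrMr // ltr_pMr // ltr1n.
  have r40 : 0 < r / 4 by rewrite divr_gt0.
  have sub w : enorm (w - z) < r / 4 -> enorm (w - a) < r * (3 / 4).
    move=> wz; rewrite -(subrKA z) (le_lt_trans (enormD _ _)) //.
    by rewrite (_ : r * (3 / 4) = r / 4 + r / 2) ?ltrD //; field.
  rewrite /L ler_pdivlMr //; apply: cauchy_jac; [exact: r40 | |].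
    by move=> w /sub ws; apply: df; exact: lt_trans r34.
  move=> w /sub ws; rewrite (le_trans (enormB _ _)) // mulr_natl mulr2n lerD ?fM //.
  by apply: sub; rewrite subrr enorm0.
pose c := r / 4 / (enorm v + 1).
have v1 : 0 < enorm v + 1 by rewrite ltr_wpDl ?enorm_ge0.
have c0 : 0 < c by rewrite !divr_gt0.
pose h (n : nat) : R := c / n.+1%:R.
have h0 n : 0 < h n by rewrite divr_gt0.
have hv n : enorm ((h n)%:C *: v) < r / 4.
  rewrite enormZ cnorm_real gtr0_norm //.
  rewrite (@le_lt_trans _ _ (c * enorm v)) //.
    by rewrite ler_wpM2r ?enorm_ge0 // ler_pdivrMr // ler_peMr ?ler1n // ltW.
  by rewrite /c mulrAC ltr_pdivrMr // ltr_pM2l ?divr_gt0 // ltrDl.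
pose G n z := (h n)^-1%:C *: (f (1 *: (h n)%:C *: v + z *m 1%:M) - f z).
pose g z := v *m 'J f z.
have [U [UU Uoo]] := ultra_oo.
have near_a n z : enorm (z - a) < r / 4 -> enorm (z - a) < r / 2 /\ enorm ((h n)%:C *: v + z *m 1%:M - a) < r / 2.
  move=> za; split; first by rewrite (lt_trans za) // ltr_pM2l // ltf_pV2 // ?ltr_nat ?posrE.
  rewrite mulmx1 -addrA (le_lt_trans (enormD _ _)) //.
  by rewrite (_ : r / 2 = r / 4 + r / 4) ?ltrD //; field.
have GH : \forall n \near U, forall z, enorm (z - a) < r / 4 ->
    differentiable (G n) z /\ enorm (G n z) <= L * enorm v.
  apply: nearW => n z za; have [z1 z2] := near_a n z za; split.
    have j1 := has_jac_affine (diff_has_jac (opJ _ z2).1).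
    have j2 := diff_has_jac (opJ _ z1).1.
    have := has_jacZ (h n)^-1%:C (has_jacB j1 j2).
    rewrite /G scale1r => /has_jac_diff[]. by [].
  rewrite /G scale1r enormZ cnorm_real gtr0_norm ?invr_gt0 // ler_pdivrMl //.
  rewrite (le_trans (mean_value_opnorm opJ z1 z2)) //.
  rewrite mulmx1 addrK enormZ cnorm_real gtr0_norm //.
  by rewrite mulrCA.
have Gg z : enorm (z - a) < r / 4 -> ulim_to U (fun n => G n z) (g z).
  move=> za e e0; have [z1 _] := near_a 0%N z za.
  have e10 : 0 < e / (enorm v + 1) by rewrite divr_gt0.
  have [dl dl0 H] := diff_has_jac (opJ _ z1).1 e10.
  have : \forall n \near U, enorm ((h n)%:C *: v) < dl.
    apply: Uoo; near=> n.
    rewrite enormZ cnorm_real gtr0_norm // /h mulrAC ltr_pdivrMr // [dl * _]mulrC -ltr_pdivrMr //.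
    by near: n; apply: filterS (nbhs_infty_gtr (c * enorm v / dl)) => n hn; apply: (lt_trans hn); rewrite ltr_nat.
  apply: filterS => n hn; have := H ((h n)%:C *: v + z).
  rewrite addrK => /(_ hn) H1.
  rewrite /G scale1r mulmx1.
  have -> : (h n)^-1%:C *: (f ((h n)%:C *: v + z) - f z) - g z =
    (h n)^-1%:C *: (f ((h n)%:C *: v + z) - f z - (h n)%:C *: v *m 'J f z).
    rewrite [RHS]scalerBr -scalemxAl scalerA -rmorphM /= mulVf ?gt_eqF // scale1r //.
  rewrite enormZ cnorm_real gtr0_norm ?invr_gt0 // ltr_pdivrMl //.
  rewrite (le_lt_trans H1) // enormZ cnorm_real gtr0_norm //.
  rewrite mulrCA ltr_pM2l // mulrAC ltr_pdivrMr // ltr_pM2l // ltrDl //.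
have r40 : enorm (a - a) < r / 4 by rewrite subrr enorm0 divr_gt0.
have [A [HA _]] := montel_jac GH Gg r40.
by have [] := has_jac_diff HA.
Unshelve. all: by end_near. Qed.


Lemma diff_bigsum (I : Type) (s : seq I) (P : pred I) (F : I -> V -> C) a :
  (forall i, differentiable (F i) a) ->
  differentiable (fun z => \sum_(i <- s | P i) F i z) a.
Proof.
move=> dF; elim: s => [|i s IH].
  have -> : (fun z => \sum_(i <- [::] | P i) F i z) = cst 0.
    by apply/funext => z; rewrite big_nil.
  exact: differentiable_cst.
have -> : (fun z => \sum_(j <- i :: s | P j) F j z) =
    (if P i then (F i + (fun z => \sum_(j <- s | P j) F j z))%R
     else (fun z => \sum_(j <- s | P j) F j z)).
  by apply/funext => z; rewrite big_cons; case: (P i).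
case: (P i); last exact: IH.
by apply: differentiableD; [exact: dF|exact: IH].
Qed.

Lemma diff_bigprod (I : Type) (s : seq I) (P : pred I) (F : I -> V -> C) a :
  (forall i, differentiable (F i) a) ->
  differentiable (fun z => \prod_(i <- s | P i) F i z) a.
Proof.
move=> dF; elim: s => [|i s IH].
  have -> : (fun z => \prod_(i <- [::] | P i) F i z) = cst 1.
    by apply/funext => z; rewrite big_nil.
  exact: differentiable_cst.
have -> : (fun z => \prod_(j <- i :: s | P j) F j z) =
    (if P i then (F i * (fun z => \prod_(j <- s | P j) F j z))%R
     else (fun z => \prod_(j <- s | P j) F j z)).
  by apply/funext => z; rewrite big_cons; case: (P i).
case: (P i); last exact: IH.
by apply: differentiableM; [exact: dF|exact: IH].
Qed.

Lemma diff_scale (c : C) (F : V -> C) a : differentiable F a ->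
  differentiable (fun z => c * F z) a.
Proof.
by move=> dF; apply: (@differentiableM _ _ (cst c) F); [exact: differentiable_cst|exact: dF].
Qed.

Lemma diff_det n (M : V -> 'M[C]_n) a :
  (forall i j, differentiable (fun z => M z i j) a) ->
  differentiable (fun z => \det (M z)) a.
Proof.
move=> dM; apply: diff_bigsum => s; apply: diff_scale.
by apply: diff_bigprod => i; exact: dM.
Qed.

Lemma diff_mulmx m n p (M : V -> 'M[C]_(m, n)) (N : V -> 'M[C]_(n, p)) a :
  (forall i j, differentiable (fun z => M z i j) a) ->
  (forall i j, differentiable (fun z => N z i j) a) ->
  forall i j, differentiable (fun z => (M z *m N z) i j) a.
Proof.
move=> dM dN i j.
have -> : (fun z => (M z *m N z) i j) = (fun z => \sum_l M z i l * N z l j).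
  by apply/funext => z; rewrite mxE.
apply: diff_bigsum => l; apply: differentiableM; [exact: dM|exact: dN].
Qed.

Lemma diff_row (F : V -> V) a :
  (forall j, differentiable (fun z => F z ord0 j) a) -> differentiable F a.
Proof.
move=> dF.
have -> : F = \sum_(j < k) (fun z => F z ord0 j *: (delta_mx ord0 j : V)).
  by apply/funext => z; rewrite fct_sumE; exact: row_sum_delta.
by apply: differentiable_sum => j; exact: differentiableZl.
Qed.

Lemma diff_jac_entry f a (r : R) i j : 0 < r ->
  (forall z, enorm (z - a) < r -> differentiable f z) ->
  differentiable (fun z => 'J f z i j) a.
Proof.
move=> r0 df.
have H := partial_diff (delta_mx ord0 i) r0 df.
have -> : (fun z => 'J f z i j) =
    (fun w : V => w ord0 j) \o (fun z => delta_mx ord0 i *m 'J f z).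
  by apply/funext => z; rewrite /= -rowE [RHS]mxE.
apply: differentiable_comp; first exact: H.
exact: differentiable_coord.
Qed.

(** On points where the differential is invertible this is u J^-1 E J; the
    adjugate makes the formula visibly holomorphic. *)
Definition conj_jac f u E z : V :=
  (\det ('J f z))^-1 *: (u *m \adj ('J f z) *m E *m 'J f z).

Lemma conj_jacE f u E z : 'J f z \in unitmx ->
  conj_jac f u E z = u *m invmx ('J f z) *m E *m 'J f z.
Proof.
by move=> J1; rewrite /invmx J1 /conj_jac -!scalemxAr -!scalemxAl.
Qed.

Lemma conj_jac_diff f u E a (r : R) : 0 < r ->
  (forall z, enorm (z - a) < r -> differentiable f z) -> 'J f a \in unitmx ->
  differentiable (conj_jac f u E) a.
Proof.
move=> r0 df J1.
have dJ i j := diff_jac_entry i j r0 df.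
have dA i j : differentiable (fun z => \adj ('J f z) i j) a.
  have -> : (fun z => \adj ('J f z) i j) = (fun z => cofactor ('J f z) j i).
    by apply/funext => z; rewrite mxE.
  apply: diff_scale; apply: diff_det => i' j'.
  have -> : (fun z => row' j (col' i ('J f z)) i' j') =
      (fun z => 'J f z (lift j i') (lift i j')).
    by apply/funext => z; rewrite !mxE.
  exact: dJ.
have dc m n (M : 'M[C]_(m, n)) i j : differentiable (fun _ : V => M i j) a.
  exact: differentiable_cst.
apply: diff_row => j.
have -> : (fun z => conj_jac f u E z ord0 j) = (fun z => (\det ('J f z))^-1 *
    (u *m \adj ('J f z) *m E *m 'J f z) ord0 j).
  by apply/funext => z; rewrite [LHS]mxE.
apply: (@differentiableM _ _ (fun z => (\det ('J f z))^-1)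
  (fun z => (u *m \adj ('J f z) *m E *m 'J f z) ord0 j)).
  apply: differentiableV; first exact: diff_det.
  by move: J1; rewrite unitmxE unitfE.
apply: diff_mulmx; last exact: dJ.
apply: diff_mulmx; last exact: dc.
by apply: diff_mulmx; [exact: dc|exact: dA].
Qed.

(** The map u J^-1 E J is bounded by Cd |E| |u| on the ball of radius r, hence by
    Cauchy's estimate it varies by O(|z| / r) from its value u E at 0. Here it is
    evaluated for u = x J (z), which makes its value at z equal to x E J (z). *)
Lemma jac_almost_commutes f E (r Cd : R) : 0 < r ->
  (forall z, enorm z < r -> [/\ differentiable f z, 'J f z \in unitmx &
     opnorm ('J f z) * opnorm (invmx ('J f z)) <= Cd]) ->
  'J f 0 = 1%:M -> forall x z, enorm z < r / 2 ->
  enorm (x *m E *m 'J f z - x *m 'J f z *m E) <=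
    4 * Cd * opnorm E / r * enorm z * enorm (x *m 'J f z).
Proof.
move=> r0 H J0 x z zr.
have z2 : enorm z < r by rewrite (lt_trans zr) // ltr_pdivrMr // ltr_pMr // ltr1n.
have [_ Jz _] := H z z2.
set u := x *m 'J f z.
pose N := conj_jac f u E.
have -> : x *m E *m 'J f z = N z by rewrite /N conj_jacE // /u mulmxK.
have -> : u *m E = N 0.
  have [|_ J1 _] := H 0; first by rewrite enorm0.
  by rewrite /N conj_jacE // J0 invmx1 !mulmx1.
pose K := Cd * opnorm E * enorm u.
have NK w : enorm w < r -> enorm (N w) <= K.
  move=> /H[_ J1 JC]; rewrite /N conj_jacE // (le_trans (opnormP _ _)) //.
  rewrite (le_trans (ler_wpM2l (opnorm_ge0 _) (opnormP _ _))) //.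
  rewrite (le_trans (ler_wpM2l (opnorm_ge0 _) (ler_wpM2l (opnorm_ge0 _) (opnormP _ _)))) //.
  rewrite /K mulrCA !mulrA ler_wpM2r ?enorm_ge0 //.
  by rewrite -mulrA [leRHS]mulrC ler_wpM2l ?opnorm_ge0.
have dN w : enorm w < r -> differentiable N w.
  move=> wr; apply: (@conj_jac_diff _ _ _ _ (r - enorm w)); first by rewrite subr_gt0.
    move=> y; rewrite ltrBrDr => yw.
    have [|h _ _] := H y; last exact: h.
    by rewrite (le_lt_trans _ yw) // -[y in enorm y](subrK w) enormD.
  by have [_ h _] := H w wr.
have r20 : 0 < r / 2 by rewrite divr_gt0.
have opN w : enorm (w - 0) < r / 2 -> differentiable N w /\ opnorm ('J N w) <= 2 * K / (r / 2).
  rewrite subr0 => wr2.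
  have wr : enorm w < r by rewrite (lt_trans wr2) // ltr_pdivrMr // ltr_pMr // ltr1n.
  split; first exact: dN.
  have sub y : enorm (y - w) < r / 2 -> enorm y < r.
    by move=> yw; rewrite -[y](subrK w) (le_lt_trans (enormD _ _)) // [r]splitr ltrD.
  rewrite ler_pdivlMr //; apply: cauchy_jac; [exact: r20| |]; move=> y /sub yr.
    exact: dN.
  by rewrite (le_trans (enormB _ _)) // mulr_natl mulr2n lerD // NK.
have := mean_value_opnorm opN (x := 0) (z := z).
rewrite !subr0 enorm0 => /(_ r20 zr) h; rewrite (le_trans h) // /K.
by rewrite le_eqVlt; apply/orP; left; apply/eqP; field; rewrite gt_eqF.
Qed.

(** Commuting with the matrix units delta_mx i j is enough. *)
Lemma scalar_of_commuting A (i0 : 'I_k) :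
  (forall i j x, x *m delta_mx i j *m A = x *m A *m delta_mx i j) ->
  A = (A i0 i0)%:M.
Proof.
move=> H.
have H' i j l m : (delta_mx i j *m A) l m = (A *m delta_mx i j) l m.
  have := H i j (delta_mx ord0 l); rewrite -!mulmxA -!rowE => /rowP/(_ m).
  by rewrite !mxE.
have dl i j l m : (delta_mx i j *m A) l m = (l == i)%:R * A j m.
  rewrite mxE (bigD1 j) //= big1 ?addr0 => [|p pj]; first by rewrite mxE eqxx andbT.
  by rewrite mxE (negbTE pj) andbF mul0r.
have dr i j l m : (A *m delta_mx i j) l m = A l i * (m == j)%:R.
  rewrite mxE (bigD1 i) //= big1 ?addr0 => [|p pi]; first by rewrite mxE eqxx.
  by rewrite mxE (negbTE pi) mulr0.
apply/matrixP => i j; rewrite mxE.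
have := H' i0 i i0 j; rewrite dl dr eqxx mul1r => ->.
by rewrite eq_sym mulr_natr.
Qed.

(** The j-th component of g depends on z_j only, hence so does its partial
    derivative phi, for each j. With two different indices, phi is constant. *)
Lemma conformal_affine g (phi : V -> C) : (1 < k)%N ->
  (forall z, has_jac g z (phi z)%:M) -> forall z, g z = g 0 + phi 0 *: z.
Proof.
move=> k1 Hg.
have phi_coord j z (d : V) : d ord0 j = 0 -> phi (z + d) = phi z.
  move=> dj; pose F z := g z *m delta_mx j j.
  have JF y : has_jac F y ((phi y)%:M *m delta_mx j j) by exact: has_jac_mulr.
  have Finv y : F (d + y *m 1%:M) = F y.
    apply/eqP; rewrite mulmx1 addrC -subr_eq0 -enorm_eq0 eq_le enorm_ge0 andbT.
    apply: mean_value => t _; have [h1 h2] := has_jac_diff (JF (y + t%:C *: d)).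
    split=> //; rewrite h2 mulmxA mul_mx_scalar -scalemxAl.
    have -> : d *m delta_mx j j = 0.
      apply/rowP => i; rewrite !mxE (bigD1 j) //= dj mul0r add0r big1 // => l lj.
      by rewrite mxE (negbTE lj) mulr0.
    by rewrite scaler0 enorm0.
  have := JF (d + z *m 1%:M) => /has_jac_affine.
  have -> : (fun y => F (d + y *m 1%:M)) = F by apply/funext.
  move=> /(has_jac_uniq (JF z)) /matrixP/(_ j j).
  rewrite mul1mx !mul_scalar_mx mulmx1 !mxE !eqxx !mulr1 addrC => ->. by [].
have phi0 z : phi z = phi 0.
  pose i0 := Ordinal (ltnW k1); pose i1 := Ordinal k1.
  pose y : V := z ord0 i0 *: delta_mx ord0 i0.
  have -> : phi z = phi y.
    rewrite -[z](addrNK y) addrC; apply: (phi_coord i0).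
    by rewrite !mxE !eqxx mulr1 subrr.
  rewrite -[y]add0r; apply: (phi_coord i1).
  by rewrite !mxE mulr0.
move=> z; apply/eqP; rewrite -subr_eq0 -enorm_eq0 eq_le enorm_ge0 andbT.
pose G y := g y - phi 0 *: y.
have JG y : has_jac G y 0.
  have := has_jacB (Hg y) (has_jacZ (phi 0) (@has_jac_id _ _ y)).
  by rewrite phi0 -[(phi 0)%:M]mulmx1 mul_scalar_mx subrr.
have : enorm (G (0 + z) - G 0) <= 0.
  apply: mean_value => t _; have [h1 ->] := has_jac_diff (JG (0 + t%:C *: z)).
  by rewrite mulmx0 enorm0.
by rewrite /G add0r scaler0 subr0 -addrA -opprD [phi 0 *: z + _]addrC.
Qed.

End Rigidity.
(** * A normality criterion *)

Section Normality.
Variables (R : realType) (k : nat).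
Local Notation C := (Cx R).
Local Notation V := 'rV[C]_k.
Implicit Types (z w u v x a : V) (A B E : 'M[C]_k) (f g : V -> V).
Local Open Scope complex_scope.

(** The balls of radius s n form an increasing open cover of K. *)
Lemma compact_exhaust (s : nat -> R) (K : set V) : {homo s : n m / (n <= m)%N >-> n <= m} ->
  compact K -> (forall z, K z -> exists n, enorm z < s n) ->
  exists n, forall z, K z -> enorm z < s n.
Proof.
move=> shomo /compact_near_coveringP cK Ks.
suff [N _ HN] : \forall n \near \oo, K `<=` (fun z => enorm z < s n).
  by exists N => z Kz; apply: (HN N (leqnn N) z Kz).
apply: cK => z /Ks[n zn].
have d0 : 0 < s n - enorm z by rewrite subr_gt0.
exists ([set w | enorm (w - z) < s n - enorm z], [set m | (n <= m)%N]).
  split=> /=; first by apply/near_enorm; exists (s n - enorm z).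
  by exists n.
move=> [w m] /= [wz nm].
rewrite (lt_le_trans _ (shomo _ _ nm)) // -[w](subrK z).
by rewrite (le_lt_trans (enormD _ _)) // -ltrBrDr.
Qed.

(** Uniform convergence on compact sets, in the form produced by an extraction:
    the m-th map is within 1 / (m + 1) of the limit on the m-th ball. *)
Lemma cvg_locunif_exhaust (D : set V) (s : nat -> R) (F : nat -> V -> V) f :
  {homo s : n m / (n <= m)%N >-> n <= m} ->
  (forall z, D z -> exists n, enorm z < s n) ->
  (forall m z, enorm z < s m -> enorm (F m z - f z) < m.+1%:R^-1) ->
  cvg_locunif D F f.
Proof.
move=> shomo Ds Ff; apply/fam_cvgP => K [KD cK].
have [N HN] := compact_exhaust shomo cK (fun z Kz => Ds z (KD z Kz)).
move=> P /uniform_nbhs[E [entE EP]].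
move: entE; rewrite -entourage_from_ballE => -[e /= /Cx_gt0[-> e0] He].
have : \forall m \near \oo, m.+1%:R^-1 < complex.Re e.
  exact: near_infty_natSinv_lt (PosNum e0).
move=> [M _ HM]; exists (maxn M N) => // m; rewrite /= geq_max => /andP[Mm Nm].
apply: EP => z Kz /=; apply: He => /=.
rewrite -ball_normE /ball_ /= -normrN opprB (le_lt_trans (normr_le_enorm _)) // ltcR.
rewrite (lt_trans _ (HM m Mm)) // Ff //.
by rewrite (lt_le_trans (HN z Kz)) // shomo.
Qed.

Lemma ultra_extract (U : set_system nat) (P : nat -> nat -> Prop) : UltraFilter U ->
  \oo `<=` U -> (forall m, \forall n \near U, P m n) ->
  exists phi : nat -> nat, increasing_seq phi /\ forall m, P m (phi m).
Proof.
move=> UU Uoo HP.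
have /choice[c Hc] (p : nat * nat) : exists n, P p.1 n /\ (p.2 < n)%N.
  have big : \forall n \near U, (p.2 < n)%N by apply: Uoo; exists p.2.+1.
  by have [n [/= h1 h2]] := filter_ex (filterI (HP p.1) big); exists n.
pose phi := fix phi m := if m is m'.+1 then c (m, phi m') else c (0%N, 0%N).
exists phi; split; last by case=> [|m]; [have [] := Hc (0, 0)%N|have [] := Hc (m.+1, phi m)].
apply/increasing_seqP => m.
by have [_] := Hc (m.+1, phi m).
Qed.

(** The radii of an exhaustion of the unit ball. *)
Definition radius (m : nat) : R := 1 - m.+2%:R^-1.

Lemma radius_homo : {homo radius : n m / (n <= m)%N >-> n <= m}.
Proof.
move=> n m nm; rewrite lerD2l lerN2 lef_pV2 ?posrE ?ltr0n //.
by rewrite ler_nat.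
Qed.

Lemma radius_lt1 m : radius m < 1.
Proof. by rewrite gtrDl oppr_lt0 invr_gt0 ltr0n. Qed.

Lemma radius_ltS m : radius m < radius m.+1.
Proof. by rewrite ltrD2l ltrN2 ltf_pV2 ?posrE ?ltr0n // ltr_nat. Qed.

Lemma radius_exhausts z : eball 1 z -> exists n, enorm z < radius n.
Proof.
rewrite /eball /= => z1.
have e0 : 0 < 1 - enorm z by rewrite subr_gt0.
have [M _ /(_ M (leqnn M)) h] := near_infty_natSinv_lt (PosNum e0).
exists M; rewrite /radius ltrBrDl -ltrBrDr (lt_trans _ h) //=.
by rewrite ltf_pV2 ?posrE ?ltr0n // ltr_nat.
Qed.

(** The logarithm of the bracket is Lipschitz on each smaller ball, uniformly
    over the family: so values are uniformly comparable to the value at 0, and a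
    sequence is either locally bounded or tends to infinity along U. *)
Lemma normal_criterion (H : set (V -> V)) :
  (forall Phi, H Phi -> holomorphic_on (eball 1) Phi) ->
  (forall s : R, s < 1 -> exists L : R, forall Phi, H Phi -> forall z, enorm z < s ->
     opnorm ('J Phi z) <= L * bracket (Phi z)) ->
  normal_on (eball 1) H.
Proof.
move=> Hol HL F HF.
have [U [UU Uoo]] := ultra_oo.
have /choice[L0 HL0] m := HL _ (radius_lt1 m).
pose L m := `|L0 m|.
have bnd m n z : enorm z < radius m -> forall t : R, 0 <= t <= 1 ->
    differentiable (F n) ((0 : V) + t%:C *: z) /\
    enorm (z *m 'J (F n) ((0 : V) + t%:C *: z)) <= L m * bracket (F n ((0 : V) + t%:C *: z)).
  move=> zm t /andP[t0 t1]; rewrite add0r.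
  have tzm : enorm (t%:C *: z) < radius m.
    rewrite enormZ cnorm_real ger0_norm // (le_lt_trans _ zm) //.
    by rewrite ler_piMl ?enorm_ge0.
  split; first by apply: (Hol _ (HF n)); rewrite /eball /= (lt_trans tzm) // radius_lt1.
  rewrite (le_trans (opnormP _ _)) //.
  rewrite (@le_trans _ _ (opnorm ('J (F n) (t%:C *: z)) * 1)) //.
    by rewrite ler_wpM2l ?opnorm_ge0 // ltW // (lt_trans zm) // radius_lt1.
  rewrite mulr1 (le_trans (HL0 _ _ (HF n) _ tzm)) //.
  by rewrite ler_wpM2r ?ler_norm // ltW // bracket_gt0.
have up m n z : enorm z < radius m -> bracket (F n z) <= bracket (F n 0) * expR (L m).
  by move=> zm; have := gronwall_upper (bnd m n z zm); rewrite add0r.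
have low m n z : enorm z < radius m -> bracket (F n 0) <= bracket (F n z) * expR (L m).
  by move=> zm; have := gronwall_lower (bnd m n z zm); rewrite add0r.
have [[M HM]|unb] := pselect (exists M : R, \forall n \near U, bracket (F n 0) <= M).
  have FM m : \forall n \near U, forall z, enorm (z - 0) < radius m ->
      differentiable (F n) z /\ enorm (F n z) <= M * expR (L m).
    apply: filterS HM => n hM z; rewrite subr0 => zm; split.
      by apply: (Hol _ (HF n)); rewrite /eball /= (lt_trans zm) // radius_lt1.
    rewrite (le_trans (enorm_le_bracket _)) // (le_trans (up m n z zm)) //.
    by rewrite ler_wpM2r ?expR_ge0.
  have /choice[g Hg] z : exists l, eball 1 z -> ulim_to U (fun n => F n z) l.
    have [z1|z1] := pselect (eball 1 z); last by exists 0.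
    have [m zm] := radius_exhausts z1.
    have [l Hl] : exists l, ulim_to U (fun n => F n z) l.
      apply: (@ulim_exists _ _ U _ _ (M * expR (L m))).
      by apply: filterS (FM m) => n /(_ z); rewrite subr0 => /(_ zm)[].
    by exists l.
  have Hgm m z : enorm (z - 0) < radius m -> ulim_to U (fun n => F n z) (g z).
    by rewrite subr0 => zm; apply: Hg; rewrite /eball /= (lt_trans zm) // radius_lt1.
  have Punif m : \forall n \near U, forall z, enorm z < radius m ->
      enorm (F n z - g z) < m.+1%:R^-1.
    have i0 : 0 < m.+1%:R^-1 :> R by rewrite invr_gt0 ltr0n.
    apply: filterS (montel_unif (FM m.+1) (@Hgm m.+1) (radius_ltS m) i0) => n h z zm.
    by apply: h; rewrite subr0.
  have [phi [phi_inc phiP]] := @ultra_extract U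
    (fun m n => forall z, enorm z < radius m -> enorm (F n z - g z) < m.+1%:R^-1) UU Uoo
    Punif.
  exists phi; split=> //; left; exists g; split.
    move=> z /radius_exhausts[m zm].
    have z0m : enorm (z - 0) < radius m by rewrite subr0.
    have [A [HA _]] := montel_jac (FM m) (@Hgm m) z0m.
    exact: (has_jac_diff HA).1.
  apply: (@cvg_locunif_exhaust _ radius) phiP; first exact: radius_homo.
  exact: radius_exhausts.
have unb' M : \forall n \near U, M < bracket (F n 0).
  have [h|h] := ultra_or (U := U) (fun n => bracket (F n 0) <= M).
    by exfalso; apply: unb; exists M.
  by apply: filterS h => n /negP; rewrite -ltNge.
have [phi [phi_inc phiP]] : exists phi : nat -> nat, increasing_seq phi /\
    forall m z, enorm z < radius m -> m%:R < enorm (F (phi m) z).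
  apply: (@ultra_extract U (fun m n => forall z, enorm z < radius m -> m%:R < enorm (F n z)) UU Uoo).
  move=> m; apply: filterS (unb' (m.+1%:R * expR (L m))) => n h z zm.
  have := lt_le_trans h (low m n z zm); rewrite ltr_pM2r ?expR_gt0 // => h2.
  have := lt_le_trans h2 (bracket_le _).
  by rewrite -natr1 addrC ltrD2l.
exists phi; split=> //; right => K [K1 cK] M.
have [N HN] := compact_exhaust radius_homo cK (fun z Kz => radius_exhausts (K1 z Kz)).
have [N2 _ HN2] := nbhs_infty_ger M.
exists (maxn N N2) => // m; rewrite /= geq_max => /andP[Nm Nm2] z Kz.
rewrite (le_lt_trans (HN2 m Nm2)) // phiP // (lt_le_trans (HN z Kz)) //.
exact: radius_homo.
Qed.

End Normality.
(** * Rescaling at points of large differential *)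

Section Rescaling.
Variables (R : realType) (k : nat).
Local Notation C := (Cx R).
Local Notation V := 'rV[C]_k.
Implicit Types (z w u v x a p : V) (A B E : 'M[C]_k) (f g : V -> V).
Local Open Scope complex_scope.

Lemma invmx_mul A B : A \in unitmx -> B \in unitmx ->
  invmx (A *m B) = invmx B *m invmx A.
Proof.
move=> Au Bu; have ABu : A *m B \in unitmx by rewrite unitmx_mul Au.
have AB1 : A *m B *m (invmx B *m invmx A) = 1%:M by rewrite mulmxA mulmxK // mulmxV.
by rewrite -[RHS](mulKmx ABu) AB1 mulmx1.
Qed.

Lemma distortionM A B (c : R) : A \in unitmx -> B \in unitmx ->
  opnorm A * opnorm (invmx A) <= c -> opnorm B * opnorm (invmx B) <= c ->
  opnorm (A *m B) * opnorm (invmx (A *m B)) <= c ^+ 2.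
Proof.
move=> Au Bu Ac Bc; rewrite invmx_mul // expr2.
apply: (@le_trans _ _ (opnorm A * opnorm B * (opnorm (invmx B) * opnorm (invmx A)))).
  by apply: ler_pM; rewrite ?opnorm_ge0 ?opnormM.
rewrite [opnorm (invmx B) * _]mulrC mulrACA.
by apply: ler_pM; [exact: mulr_ge0 (opnorm_ge0 _) (opnorm_ge0 _)
  |exact: mulr_ge0 (opnorm_ge0 _) (opnorm_ge0 _)|exact: Ac|exact: Bc].
Qed.

(** Take p maximizing (s - |z|) |J f z| / bracket (f z) up to a factor 2 over the
    ball of radius s, and rho = (s - |p|) / 2. The weight s - |z| is at least half
    of s - |p| at distance less than rho from p, whence the factor 4, and rho mu is
    half of the weighted value at p. *)
Lemma point_picking f (s0 s L : R) z0 : 0 < s0 -> s0 < s -> s < 1 -> 0 < L ->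
  holomorphic_on (eball 1) f -> enorm z0 < s0 ->
  L * bracket (f z0) < opnorm ('J f z0) ->
  exists p (mu rho : R), [/\ 0 < mu, 0 < rho, enorm p + rho < 1,
    opnorm ('J f p) = mu * bracket (f p) &
    (s - s0) * L / 4 <= rho * mu /\
    forall z, enorm (z - p) < rho -> opnorm ('J f z) <= 4 * mu * bracket (f z)].
Proof.
move=> s00 s0s s1 L0 df z0s big.
pose M z := opnorm ('J f z) / bracket (f z).
have M0 z : 0 <= M z by rewrite divr_ge0 ?opnorm_ge0 // ltW // bracket_gt0.
have [h1 h2] : s < (s + 1) / 2 /\ (s + 1) / 2 < 1 by have [] := midf_lt s1.
set t := (s + 1) / 2 in h1 h2.
have [N N0 fN] : exists2 N : R, 0 <= N & forall z, enorm (z - 0) < t -> enorm (f z) <= N.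
  by apply: (bounded_on_ball h2) => z; rewrite subr0; exact: df.
have ts : 0 < t - s by rewrite subr_gt0.
have Mbound z : enorm z < s -> M z <= 2 * N / (t - s).
  move=> zs; rewrite /M ler_pdivrMr ?bracket_gt0 //.
  have NN : 0 <= 2 * N / (t - s) by rewrite divr_ge0 ?mulr_ge0 // ltW.
  rewrite (@le_trans _ _ (2 * N / (t - s) * 1)) //; last first.
    by rewrite ler_wpM2l // bracket_ge1.
  rewrite mulr1 ler_pdivlMr //.
  have sub w : enorm (w - z) < t - s -> enorm w < t.
    move=> wz; rewrite -[w](subrK z) (le_lt_trans (enormD _ _)) //.
    by rewrite -[t](subrK s) ltrD.
  apply: cauchy_jac; [exact: ts| |]; move=> w /sub wt.
    by apply: df; rewrite /eball /= (lt_trans wt).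
  rewrite (le_trans (enormB _ _)) // mulr_natl mulr2n lerD // fN // subr0 //.
  by rewrite (lt_trans zs).
pose Q := [set (s - enorm z) * M z | z in [set z | enorm z < s]].
have z0s' : enorm z0 < s by rewrite (lt_trans z0s).
have hQ : has_sup Q.
  split; first by exists ((s - enorm z0) * M z0), z0.
  exists (s * (2 * N / (t - s))) => _ [z /= zs <-].
  by rewrite ler_pM ?Mbound // ?subr_ge0 ?(ltW zs) // gerBl enorm_ge0.
have ML : L <= M z0 by rewrite /M ler_pdivlMr ?bracket_gt0 // ltW.
have X1 : (s - s0) * L <= sup Q.
  apply: (@le_trans _ _ ((s - enorm z0) * M z0)).
    rewrite ler_pM ?(ltW L0) ?subr_ge0 ?(ltW s0s) //.
    by rewrite lerD2l lerN2 ltW.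
  by apply: (ub_le_sup hQ.2); exists z0.
have X0 : 0 < sup Q by rewrite (lt_le_trans _ X1) // mulr_gt0 // subr_gt0.
have X20 : 0 < sup Q / 2 by rewrite divr_gt0.
have [_ [p /= ps <-] pX] := sup_adherent X20 hQ.
have {}pX : sup Q / 2 < (s - enorm p) * M p by move: pX; rewrite {1}[sup Q]splitr addrK.
have sp : 0 < s - enorm p by rewrite subr_gt0.
have Mp : 0 < M p by rewrite -(pmulr_rgt0 _ sp) (lt_trans X20).
exists p, (M p), ((s - enorm p) / 2); split => //.
- by rewrite divr_gt0.
- rewrite (lt_trans _ s1) //.
  have : (s - enorm p) / 2 < s - enorm p by rewrite ltr_pdivrMr // ltr_pMr // ltr1n.
  by rewrite ltrBrDl.
- by rewrite /M divfK // gt_eqF // bracket_gt0.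
split.
  have -> : (s - enorm p) / 2 * M p = (s - enorm p) * M p / 2 by field.
  move: X1 pX; move: ((s - s0) * L) ((s - enorm p) * M p) (sup Q) => *; lra.
move=> z zp.
have zs : (s - enorm p) / 2 <= s - enorm z.
  have : enorm z <= (s - enorm p) / 2 + enorm p.
    by rewrite -[z](subrK p) (le_trans (enormD _ _)) // lerD2r ltW.
  move: (enorm z) (enorm p) => y q; lra.
have zs' : enorm z < s by rewrite -subr_gt0 (lt_le_trans _ zs) // divr_gt0.
rewrite -ler_pdivrMr ?bracket_gt0 // -/(M z).
have hz : (s - enorm z) * M z <= sup Q by apply: (ub_le_sup hQ.2); exists z.
have : (s - enorm p) / 2 * M z <= (s - enorm p) / 2 * (4 * M p).
  rewrite (le_trans (ler_wpM2r (M0 z) zs)) // (le_trans hz) //.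
  have -> : (s - enorm p) / 2 * (4 * M p) = 2 * ((s - enorm p) * M p) by field.
  by rewrite -ler_pdivrMl // mulrC ltW.
by rewrite ler_pM2l // divr_gt0.
Qed.

(** Here B = bracket (f p) (J f p)^-1, of norm at most Cd / mu. The differential at
    0 becomes a multiple of the identity, at the price of squaring the distortion. *)
Lemma rescale f p (mu rho Cd : R) : 0 < Cd -> 0 < mu -> 0 < rho -> enorm p + rho < 1 ->
  holomorphic_on (eball 1) f ->
  (forall z, eball 1 z -> 'J f z \in unitmx /\
     opnorm ('J f z) * opnorm (invmx ('J f z)) <= Cd) ->
  opnorm ('J f p) = mu * bracket (f p) ->
  (forall z, enorm (z - p) < rho -> opnorm ('J f z) <= 4 * mu * bracket (f z)) ->
  exists2 B : 'M[C]_k, B \in unitmx &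
    let Psi z := f (p + z *m B) in
    (forall z, enorm z < rho * mu / Cd ->
       [/\ eball 1 (p + z *m B), differentiable Psi z, 'J Psi z \in unitmx,
         opnorm ('J Psi z) * opnorm (invmx ('J Psi z)) <= Cd ^+ 2 &
         opnorm ('J Psi z) <= 4 * Cd * bracket (Psi z)]) /\
    'J Psi 0 = (bracket (Psi 0))%:C%:M.
Proof.
move=> C0 mu0 rho0 prho df dist Jp Jz.
have bp : 0 < bracket (f p) := bracket_gt0 _.
have p1 : eball 1 p by rewrite /eball /= (lt_trans _ prho) // ltrDl.
have [Jpu Jpd] := dist p p1.
have b0 : (bracket (f p))%:C != 0 :> C by rewrite -cnorm_eq0 cnorm_real normr_eq0 gt_eqF.
pose B := (bracket (f p))%:C *: invmx ('J f p).
have Bu : B \in unitmx by rewrite unitmxZ ?unitmx_inv // unitfE.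
have opB : opnorm B <= Cd / mu.
  rewrite ler_pdivlMr // (le_trans (ler_wpM2r (ltW mu0) (opnormZ_le _ _))) //.
  rewrite cnorm_real gtr0_norm // mulrAC [_ * mu]mulrC -Jp. exact: Jpd.
have opBV : opnorm B * opnorm (invmx B) <= Cd.
  have -> : invmx B = (bracket (f p))^-1%:C *: 'J f p.
    by rewrite invmxZ ?unitmx_inv // invmxK fmorphV.
  rewrite (le_trans (ler_pM (opnorm_ge0 _) (opnorm_ge0 _) (opnormZ_le _ _) (opnormZ_le _ _))) //.
  rewrite !cnorm_real !gtr0_norm ?invr_gt0 // mulrACA mulfV ?gt_eqF // mul1r mulrC.
  exact: Jpd.
exists B; first exact: Bu.
move=> Psi.
have sub z : enorm z < rho * mu / Cd -> enorm (p + z *m B - p) < rho.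
  move=> zr; rewrite addrAC subrr add0r (le_lt_trans (opnormP _ _)) //.
  rewrite (le_lt_trans (ler_wpM2r (enorm_ge0 _) opB)) //.
  by rewrite mulrC mulrA ltr_pdivrMr // -ltr_pdivlMr.
have sub1 z : enorm z < rho * mu / Cd -> eball 1 (p + z *m B).
  move=> /sub; rewrite /eball /= => h; rewrite (lt_trans _ prho) //.
  by rewrite -[X in enorm X](subrK p) addrC (le_lt_trans (enormD _ _)) // ltrD2l.
have JPsi z : enorm z < rho * mu / Cd -> differentiable Psi z /\ 'J Psi z = B *m 'J f (p + z *m B).
  by move=> /sub1/df/diff_has_jac/has_jac_affine/has_jac_diff.
have r0 : 0 < rho * mu / Cd by rewrite divr_gt0 // mulr_gt0.
split.
  move=> z zr; have [d JE] := JPsi z zr.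
  have z1 := sub1 z zr; have [Ju Jd] := dist _ z1.
  split; [exact: z1|exact: d| | |]; rewrite JE ?unitmx_mul ?Bu //.
    exact: distortionM.
  rewrite (le_trans (opnormM _ _)) //.
  rewrite (le_trans (ler_pM (opnorm_ge0 _) (opnorm_ge0 _) opB (Jz _ (sub z zr)))) //.
  by rewrite le_eqVlt; apply/orP; left; apply/eqP; rewrite /Psi; field; rewrite gt_eqF.
have [_ ->] : differentiable Psi 0 /\ 'J Psi 0 = B *m 'J f (p + 0 *m B).
  by apply: JPsi; rewrite enorm0.
by rewrite /Psi mul0mx addr0 /B -scalemxAl mulVmx // scalemx1.
Qed.

End Rescaling.
(** * Limits of rescaled maps are affine *)

Section AffineLimit.
Variables (R : realType) (k : nat).
Local Notation C := (Cx R).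
Local Notation V := 'rV[C]_k.
Implicit Types (z w u v x a p : V) (A B E : 'M[C]_k).
Local Open Scope complex_scope.

Lemma distortionZ (c : C) A : c != 0 -> A \in unitmx -> c *: A \in unitmx /\
  opnorm (c *: A) * opnorm (invmx (c *: A)) <= opnorm A * opnorm (invmx A).
Proof.
move=> c0 Au; have cA : c *: A \in unitmx by rewrite unitmxZ ?unitfE.
split; first exact: cA.
rewrite (invmxZ cA).
apply: (le_trans (ler_pM (opnorm_ge0 _) (opnorm_ge0 _) (opnormZ_le _ _) (opnormZ_le _ _))).
by rewrite cnormV mulrACA mulfV ?mul1r // cnorm_eq0.
Qed.

(** Divide Psi n by the bracket b n of its value at 0, which is also the factor
    of its differential there. The quotients G n tend to z |-> g 0 + z, and the
    zero of this limit bounds b n. *)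
Lemma affine_limit (Psi : nat -> V -> V) (Cd L : R) (U : set_system nat) :
  UltraFilter U -> \oo `<=` U -> (1 < k)%N -> 0 <= L ->
  (forall n z, enorm z < n.+1%:R -> [/\ differentiable (Psi n) z,
     'J (Psi n) z \in unitmx,
     opnorm ('J (Psi n) z) * opnorm (invmx ('J (Psi n) z)) <= Cd &
     opnorm ('J (Psi n) z) <= L * bracket (Psi n z)]) ->
  (forall n, 'J (Psi n) 0 = (bracket (Psi n 0))%:C%:M) ->
  exists (b : R) (c : V), 0 < b /\ forall r e : R, 0 < e ->
    \forall n \near U, forall z, enorm z < r -> enorm (Psi n z - (c + b%:C *: z)) < e.
Proof.
move=> UU Uoo k1 L0 HPsi HPsi0.
pose b n := bracket (Psi n 0).
have b1 n : 1 <= b n := bracket_ge1 _.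
have b0 n : 0 < b n := bracket_gt0 _.
have bn0 n : b n != 0 by rewrite gt_eqF.
have biu n : ((b n)^-1%:C : C) != 0.
  by rewrite -cnorm_eq0 cnorm_real normr_eq0 invr_eq0.
pose G n z := (b n)^-1%:C *: Psi n z.
have PsiG n z : Psi n z = (b n)%:C *: G n z.
  by rewrite /G scalerA -rmorphM /= mulfV // scale1r.
have big (r : R) : \forall n \near U, r < n.+1%:R.
  apply: Uoo; apply: filterS (nbhs_infty_gtr r) => n h; apply: (lt_trans h).
  by rewrite ltr_nat.
have seg n z : enorm z < n.+1%:R -> forall t : R, 0 <= t <= 1 ->
    differentiable (Psi n) ((0 : V) + t%:C *: z) /\
    enorm (z *m 'J (Psi n) ((0 : V) + t%:C *: z)) <=
      L * enorm z * bracket (Psi n ((0 : V) + t%:C *: z)).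
  move=> zn t /andP[t0 t1]; rewrite add0r.
  have tzn : enorm (t%:C *: z) < n.+1%:R.
    rewrite enormZ cnorm_real ger0_norm // (le_lt_trans _ zn) //.
    by rewrite ler_piMl ?enorm_ge0.
  have [d _ _ h] := HPsi n _ tzn; split; first exact: d.
  rewrite (le_trans (opnormP _ _)) // mulrAC.
  by rewrite ler_wpM2r ?enorm_ge0.
have up n z : enorm z < n.+1%:R -> bracket (Psi n z) <= b n * expR (L * enorm z).
  by move=> zn; have := gronwall_upper (seg n z zn); rewrite add0r.
have low n z : enorm z < n.+1%:R -> b n <= bracket (Psi n z) * expR (L * enorm z).
  by move=> zn; have := gronwall_lower (seg n z zn); rewrite add0r.
have GB (r : R) : \forall n \near U, forall z, enorm (z - 0) < r ->
    differentiable (G n) z /\ enorm (G n z) <= expR (L * r).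
  apply: filterS (big r) => n rn z; rewrite subr0 => zr.
  have zn : enorm z < n.+1%:R by exact: lt_trans rn.
  have [d _ _ _] := HPsi n z zn; split.
    exact: (has_jac_diff (has_jacZ _ (diff_has_jac d))).1.
  rewrite enormZ cnorm_real gtr0_norm ?invr_gt0 // ler_pdivrMl //.
  rewrite (le_trans (enorm_le_bracket _)) // (le_trans (up n z zn)) //.
  by rewrite ler_pM2l // ler_expR ler_wpM2l // ltW.
have JG n z : enorm z < n.+1%:R -> 'J (G n) z = (b n)^-1%:C *: 'J (Psi n) z.
  move=> zn; have [d _ _ _] := HPsi n z zn.
  exact: (has_jac_diff (has_jacZ _ (diff_has_jac d))).2.
have /choice[g Hg] z : exists l, ulim_to U (fun n => G n z) l.
  apply: (@ulim_exists _ _ U _ _ (expR (L * (enorm z + 1)))).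
  apply: filterS (GB (enorm z + 1)) => n /(_ z); rewrite subr0 ltrDl => /(_ ltr01)[] //.
have gJ z : exists A, has_jac g z A /\ forall v, ulim_to U (fun n => v *m 'J (G n) z) (v *m A).
  have zr : enorm (z - 0) < enorm z + 1 by rewrite subr0 ltrDl.
  exact: (montel_jac (GB (enorm z + 1)) (fun w _ => Hg w) zr).
have gcomm z A : has_jac g z A -> (forall v, ulim_to U (fun n => v *m 'J (G n) z) (v *m A)) ->
    forall E x, x *m E *m A = x *m A *m E.
  move=> _ HA E x; apply/eqP; rewrite -subr_eq0 -enorm_eq0 eq_le enorm_ge0 andbT.
  apply/ler_addgt0Pr => e e0; rewrite add0r.
  have lim1 := ulimD (HA (x *m E)) (ulimZ (-1) (ulim_mulmx E (HA x))).
  rewrite scaleN1r in lim1; rewrite -[X in enorm X]subr0; apply: (ulim_le (lim1 UU UU UU)).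
  pose Q := 4 * Cd * opnorm E * enorm z * (enorm (x *m A) + 1).
  have near1 := HA x 1 ltr01.
  apply: filterS3 near1 (big (2 * enorm z)) (big (Q / e)) => n xn n1 n2.
  have n0 : 0 < n.+1%:R :> R by rewrite ltr0n.
  have zn : enorm z < n.+1%:R / 2 by rewrite ltr_pdivlMr // mulrC.
  have Cd0 : 0 <= Cd.
    have [|_ _ h _] := HPsi n 0; first by rewrite enorm0.
    by rewrite (le_trans _ h) // mulr_ge0 // opnorm_ge0.
  have HG w : enorm w < n.+1%:R -> [/\ differentiable (G n) w, 'J (G n) w \in unitmx &
      opnorm ('J (G n) w) * opnorm (invmx ('J (G n) w)) <= Cd].
    move=> wn; have [d Ju Jd _] := HPsi n w wn.
    have [u1 u2] := distortionZ (biu n) Ju.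
    split; first exact: (has_jac_diff (has_jacZ _ (diff_has_jac d))).1.
      by rewrite (JG n w wn).
    by rewrite (JG n w wn); exact: le_trans u2 Jd.
  have JG0 : 'J (G n) 0 = 1%:M.
    by rewrite JG ?enorm0 // HPsi0 scale_scalar_mx -rmorphM /= mulVf.
  have := jac_almost_commutes E n0 HG JG0 x zn.
  rewrite subr0 scaleN1r => h; rewrite (le_trans h) //.
  have xl : enorm (x *m 'J (G n) z) <= enorm (x *m A) + 1.
    by rewrite -lerBlDl (le_trans (enormB_ge _ _)) // ltW.
  have c0 : 0 <= 4 * Cd * opnorm E / n.+1%:R * enorm z.
    by rewrite !mulr_ge0 ?invr_ge0 ?enorm_ge0 ?opnorm_ge0 // ltW.
  rewrite (le_trans (ler_wpM2l c0 xl)) //.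
  have -> : 4 * Cd * opnorm E / n.+1%:R * enorm z * (enorm (x *m A) + 1) = Q / n.+1%:R.
    by rewrite /Q; field; rewrite gt_eqF.
  by rewrite ler_pdivrMr // mulrC -ler_pdivrMr // ltW.
pose i0 := Ordinal (ltnW k1).
have /choice[phi Hphi] z : exists c : C, has_jac g z c%:M.
  have [A [HA HA2]] := gJ z.
  exists (A i0 i0); rewrite -(@scalar_of_commuting _ _ A i0) //.
  by move=> i j x; exact: (gcomm z A HA HA2).
have phi0 : phi 0 = 1.
  have [A [HA HA2]] := gJ 0.
  have E := has_jac_uniq HA (Hphi 0).
  have h1 := HA2 (delta_mx ord0 i0).
  have h2 : ulim_to U (fun n => delta_mx ord0 i0 *m 'J (G n) 0) (delta_mx ord0 i0).
    move=> e e0; apply: nearW => n.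
    have -> : 'J (G n) 0 = 1%:M.
      by rewrite JG ?enorm0 ?ltr0n // HPsi0 scale_scalar_mx -rmorphM /= mulVf.
    by rewrite mulmx1 subrr enorm0.
  have hE : delta_mx ord0 i0 *m A = delta_mx ord0 i0 :> V by exact: ulim_uniq h1 h2.
  move: hE; rewrite E mul_mx_scalar => /rowP/(_ i0).
  by rewrite !mxE !eqxx mulr1.
have gE z : g z = g 0 + z by rewrite (conformal_affine k1 Hphi z) phi0 scale1r.
(* b n <= bracket (Psi n z) K and |Psi n z| <= b n / (2 K) at the zero z of g *)
have bbd : exists M : R, \forall n \near U, `|b n| <= M.
  pose z := - g 0; pose K := expR (L * enorm z).
  have K0 : 0 < K by rewrite expR_gt0.
  exists (2 * K).
  have K20 : 0 < (2 * K)^-1 by rewrite invr_gt0 mulr_gt0.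
  have gz : g z = 0 by rewrite gE subrr.
  have := Hg z _ K20; rewrite gz => small.
  apply: filterS2 small (big (enorm z)) => n sn zn; rewrite subr0 in sn.
  rewrite ger0_norm ?(ltW (b0 n)) //.
  have h := le_trans (low n z zn) (ler_wpM2r (ltW K0) (bracket_le _)).
  have PG : enorm (Psi n z) <= b n * (2 * K)^-1.
    by rewrite PsiG enormZ cnorm_real gtr0_norm // ler_pM2l // ltW.
  have h2 : b n <= (1 + b n * (2 * K)^-1) * K.
    by rewrite (le_trans h) // ler_pM2r // lerD2l.
  have E : (1 + b n * (2 * K)^-1) * K = K + b n / 2 by field; rewrite gt_eqF.
  by rewrite E in h2; move: h2; move: (b n) K {K0 K20 E PG h sn zn} => y q; lra.
have [M HM] := bbd.
have [bl Hbl] := ultra_real HM.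
have bl1 : 1 <= bl.
  apply/ler_addgt0Pr => e e0.
  have [n] := filter_ex (Hbl e e0); rewrite ltr_norml => /andP[_ h].
  by rewrite (le_trans (b1 n)) // -lerBlDl ltW.
exists bl, (bl%:C *: g 0); split; first exact: lt_le_trans bl1.
move=> r e e0; pose N := enorm (g 0) + `|r| + 1.
have N0 : 0 < N by rewrite ltr_wpDl // addr_ge0 ?enorm_ge0.
pose M1 := `|M| + 1; have M10 : 0 < M1 by rewrite ltr_wpDl.
have eN : 0 < e / 2 / N by rewrite !divr_gt0.
have eM : 0 < e / 2 / M1 by rewrite !divr_gt0.
have rr : r < r + 1 by rewrite ltrDl.
have unif : \forall n \near U, forall z, enorm (z - 0) < r ->
    enorm (G n z - g z) < e / 2 / M1.
  exact: (montel_unif (GB (r + 1)) (fun w _ => Hg w) rr eM).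
apply: filterS3 HM (Hbl _ eN) unif => n bM bb un z zr.
have -> : Psi n z - (bl%:C *: g 0 + bl%:C *: z) =
    (b n)%:C *: (G n z - g z) + (b n - bl)%:C *: g z.
  rewrite (gE z) -scalerDr PsiG rmorphB /= scalerBr scalerBl.
  by rewrite addrA subrK.
rewrite (le_lt_trans (enormD _ _)) // !enormZ !cnorm_real (splitr e) ltr_leD //.
  have -> : e / 2 = M1 * (e / 2 / M1) by field; rewrite gt_eqF.
  rewrite (@le_lt_trans _ _ (M1 * enorm (G n z - g z))) //.
    rewrite ler_wpM2r ?enorm_ge0 // (le_trans bM) // (le_trans (ler_norm _)) //.
    by rewrite lerDl.
  by rewrite ltr_pM2l // un // subr0.
have -> : e / 2 = e / 2 / N * N by field; rewrite gt_eqF.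
rewrite ler_pM ?enorm_ge0 ?(ltW bb) // (gE z) (le_trans (enormD _ _)) //.
rewrite /N -addrA lerD2l (le_trans (ltW zr)) // (le_trans (ler_norm _)) // lerDl //.
Qed.

End AffineLimit.

(* The values of Phi n (a n + z *m B n) with enorm z >= r n are irrelevant to
   the convergence, since every compact set lies in eball (r n) for n large. *)
Theorem theorem2p1 (R : realType) (k : nat) (hk : (1 < k)%N)
    (C : R) (hC : 0 < C)
    (H : set ('rV[Cx R]_k -> 'rV[Cx R]_k))
    (H_holo : forall Phi, H Phi -> holomorphic_on (eball 1) Phi)
    (H_dist : forall Phi, H Phi -> forall a, eball 1 a ->
       'J Phi a \in unitmx /\
       opnorm ('J Phi a) * opnorm (invmx ('J Phi a)) <= C)
    (H_not_normal : ~ normal_on (eball 1) H) :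
  exists (Phi : nat -> 'rV[Cx R]_k -> 'rV[Cx R]_k) (a : nat -> 'rV[Cx R]_k)
         (B : nat -> 'M[Cx R]_k) (r : nat -> R)
         (Psi : 'rV[Cx R]_k -> 'rV[Cx R]_k),
    [/\ forall n, H (Phi n),
        forall n, [/\ eball 1 (a n), B n \in unitmx & 0 < r n],
        r @ \oo --> +oo,
        forall n z, eball (r n) z -> eball 1 (a n + z *m B n)
      & [/\ cvg_locunif setT (fun n z => Phi n (a n + z *m B n)) Psi,
            holomorphic_on setT Psi
          & nondegenerate_map Psi]].
Proof.
have [s s1 big] : exists2 s : R, s < 1 & forall L : R, exists Phi,
    H Phi /\ exists2 z, enorm z < s & L * bracket (Phi z) < opnorm ('J Phi z).
  apply: contrapT => no; apply: H_not_normal; apply: normal_criterion => // s s1.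
  apply: contrapT => noL; apply: no; exists s => // L.
  apply: contrapT => noPhi; apply: noL; exists L => Phi HPhi z zs.
  rewrite leNgt; apply/negP => lt; apply: noPhi; exists Phi; split => //.
  by exists z.
have s0 : 0 < s.
  have [Phi [_ [z zs _]]] := big 0.
  exact: le_lt_trans (enorm_ge0 _) zs.
have [st t1] : s < (s + 1) / 2 /\ (s + 1) / 2 < 1 by have [] := midf_lt s1.
set t := (s + 1) / 2 in st t1.
have ts : 0 < t - s by rewrite subr_gt0.
pose good n (q : ('rV[Cx R]_k -> 'rV[Cx R]_k) * 'rV[Cx R]_k * 'M[Cx R]_k) :=
  let: (Phi, p, B) := q in
  let Psi z := Phi (p + z *m B) in
  [/\ H Phi, eball 1 p, B \in unitmx &
   (forall z, enorm z < n.+1%:R ->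
       [/\ eball 1 (p + z *m B), differentiable Psi z, 'J Psi z \in unitmx,
         opnorm ('J Psi z) * opnorm (invmx ('J Psi z)) <= C ^+ 2 &
         opnorm ('J Psi z) <= 4 * C * bracket (Psi z)]) /\
    'J Psi 0 = (real_complex R (bracket (Psi 0)))%:M].
have /choice[q Hq] n : exists q, good n q.
  (* this L makes the radius rho * mu / C of the rescaled ball at least n + 1 *)
  pose L := n.+1%:R * (4 * C / (t - s)).
  have L0 : 0 < L by rewrite mulr_gt0 ?ltr0n // divr_gt0 // mulr_gt0.
  have [Phi [HPhi [z0 z0s hz0]]] := big L.
  have [p [mu [rho [mu0 rho0 prho Jp [rhomu Jz]]]]] :=
    point_picking s0 st t1 L0 (H_holo Phi HPhi) z0s hz0.
  have [B Bu [P1 P2]] := rescale hC mu0 rho0 prho (H_holo Phi HPhi) (H_dist Phi HPhi) Jp Jz.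
  have n1 : n.+1%:R <= rho * mu / C.
    rewrite ler_pdivlMr // (le_trans _ rhomu) // /L le_eqVlt.
    by apply/orP; left; apply/eqP; field; rewrite gt_eqF.
  exists (Phi, p, B); split; [exact: HPhi| |exact: Bu|split; last exact: P2].
    by rewrite /eball /= (lt_trans _ prho) // ltrDl.
  by move=> z zn; apply: P1; exact: lt_le_trans n1.
pose Psi n z := (q n).1.1 ((q n).1.2 + z *m (q n).2).
have HPsi n : [/\ H (q n).1.1, eball 1 (q n).1.2, (q n).2 \in unitmx &
   (forall z, enorm z < n.+1%:R ->
       [/\ eball 1 ((q n).1.2 + z *m (q n).2), differentiable (Psi n) z, 'J (Psi n) z \in unitmx,
         opnorm ('J (Psi n) z) * opnorm (invmx ('J (Psi n) z)) <= C ^+ 2 &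
         opnorm ('J (Psi n) z) <= 4 * C * bracket (Psi n z)]) /\
    'J (Psi n) 0 = (real_complex R (bracket (Psi n 0)))%:M].
  by have := Hq n; rewrite /Psi; case: (q n) => [[Phi p] B].
have [U [UU Uoo]] := ultra_oo.
have C40 : 0 <= 4 * C by rewrite mulr_ge0 // ltW.
have hA n z : enorm z < n.+1%:R -> [/\ differentiable (Psi n) z,
     'J (Psi n) z \in unitmx,
     opnorm ('J (Psi n) z) * opnorm (invmx ('J (Psi n) z)) <= C ^+ 2 &
     opnorm ('J (Psi n) z) <= 4 * C * bracket (Psi n z)].
  by have [_ _ _ [h _]] := HPsi n; move=> /h[_ d1 d2 d3 d4]; split; [exact: d1|exact: d2|exact: d3|exact: d4].
have hB n : 'J (Psi n) 0 = (real_complex R (bracket (Psi n 0)))%:M.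
  by have [_ _ _ [_]] := HPsi n.
have [b [c [b0 cv]]] := affine_limit UU Uoo hk C40 hA hB.
pose Psi0 z : 'rV[Cx R]_k := c + real_complex R b *: z.
have [phi [phi_inc phiP]] := @ultra_extract U
  (fun m n => forall z, enorm z < m.+1%:R -> enorm (Psi n z - Psi0 z) < m.+1%:R^-1) UU Uoo
  (fun m => cv m.+1%:R m.+1%:R^-1 ltac:(by rewrite invr_gt0 ltr0n)).
have phi_ge m : (m <= phi m)%N.
  elim: m => // m IH; apply: (leq_ltn_trans IH).
  by have /increasing_seqP := phi_inc; apply.
have JPsi0 z : has_jac Psi0 z (real_complex R b)%:M.
  have h := has_jacB (has_jacZ (real_complex R b) (@has_jac_id _ _ z)) (@has_jac_cst _ _ z (- c)).
  rewrite subr0 scalemx1 in h.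
  have -> : Psi0 = (fun w => real_complex R b *: id w - - c).
    by apply/funext => w; rewrite opprK addrC.
  exact: h.
exists (fun m => (q (phi m)).1.1), (fun m => (q (phi m)).1.2), (fun m => (q (phi m)).2),
  (fun m => m.+1%:R), Psi0.
split.
- by move=> n; have [] := HPsi (phi n).
- by move=> n; have [_ h1 h2 _] := HPsi (phi n); split=> //; rewrite ltr0n.
- apply/cvgryPge => A; apply: filterS (nbhs_infty_ger A) => n h.
  by rewrite (le_trans h) // ler_nat.
- move=> n z zn; have [_ _ _ [h _]] := HPsi (phi n).
  have [//|h1 _ _ _ _] := h z.
    by rewrite (lt_le_trans zn) // ler_nat ltnS.
  exact: h1.
split.
- apply: (@cvg_locunif_exhaust _ _ _ (fun m => m.+1%:R)) phiP.
    by move=> n m nm; rewrite ler_nat ltnS.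
  move=> z _; have [n _ /(_ n (leqnn n)) h] := nbhs_infty_gtr (enorm z).
  by exists n; rewrite (lt_trans h) // ltr_nat.
- by move=> z _; exact: (has_jac_diff (JPsi0 z)).1.
- move=> /(_ 0); rewrite (has_jac_diff (JPsi0 0)).2 det_scalar => /eqP.
  by rewrite expf_eq0 -cnorm_eq0 cnorm_real normr_eq0 gt_eqF // andbF.
Qed.
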